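(* Let $C\subseteq C_{\hat p}$ be a cut which is a sub-semiring of ${}^*\mathbb N$ (closed under addition and multiplication, containing $0$ and $1$). Then $\mathbb R^C:=f_{\overline{\mathbb Q}}^{-1}[C]$ is a real-closed field whose ordering is the relation $\le$. In particular $\mathbb R^\delta:=f_{\overline{\mathbb Q}}^{-1}[C_{\hat p}]$ is a real-closed field.
   Context: Let $\mathcal F$ be a countably incomplete ultrafilter on a set $I$, ${}^*\mathbb N=\mathbb N^I/\mathcal F$ (with $\mathbb N\subseteq{}^*\mathbb N$), and call a set internal if it lies in ${}^*A$ for some $A$ in the superstructure $V(\mathbb N)$, where $*$ is the elementary embedding induced by the ultrapower. Let $\hat p\in{}^*\mathbb N\setminus\mathbb N$ be a nonstandard prime and $\mathbb F_{\hat p}=\{\hat n:\hat n<\hat p\}$ with operations modulo $\hat p$. Standing assumptions: $\mathbb F_{\hat p}$ contains a subfield isomorphic to the field $\overline{\mathbb Q}\cap\mathbb R$ of real algebraic numbers, and $\mathbb F_{\hat p}$ contains no square root of $-1$. For $a\in\mathbb F_{\hat p}$ let $|a|=\min(a,\hat p-a)$. Define the internal function $f_{\overline{\mathbb Q}}:\mathbb F_{\hat p}\to{}^*\mathbb N$ by letting $f_{\overline{\mathbb Q}}(x)$ be the minimum of $n+\lceil\log_2\max(m,k)\rceil$ over all $n,m,k\in{}^*\mathbb N$ with $n\ge1$, $k\ne0$ in $\mathbb F_{\hat p}$, such that $kx$ is an eigenvalue of some internal $n\times n$ matrix over $\mathbb F_{\hat p}$ all of whose entries have absolute value at most $m$.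 For $\hat n\in{}^*\mathbb N$ let $[\hat n]=\{\hat m\in{}^*\mathbb N:\hat m<\hat n\}$. Let $\phi_2(\hat n)$ be: for all $x,y\in f_{\overline{\mathbb Q}}^{-1}[[\hat n]]$ there is $z\in\mathbb F_{\hat p}$ with $x^2+y^2=z^2$; for odd standard $d>1$ let $\phi_d(\hat n)$ be: for all $a_0,\dots,a_{d-1}\in f_{\overline{\mathbb Q}}^{-1}[[\hat n]]$ there is $x\in\mathbb F_{\hat p}$ with $x^d+\sum_{i<d}a_ix^i=0$. For each $d\in\{2,3,5,7,9,\dots\}$ the set of $\hat n$ satisfying $\phi_d$ is internal, downward closed, contains $\mathbb N$ and omits $\hat p$; let $\hat n_d$ be its maximum. Define $C_{\hat p}=\bigcap_{d\in\{2,3,5,7,\dots\},\,i\ge1}\,[\lceil\hat n_d^{1/i}\rceil]$ (the ceiling of the $i$-th root taken internally). A cut is a downward-closed subset of ${}^*\mathbb N$. For $a,b\in\mathbb F_{\hat p}$, $a\le b$ means that $b-a=x^2$ for some $x\in\mathbb F_{\hat p}$. *)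

(* Defs.v *)
From HB Require Import structures.
From mathcomp Require Import all_boot all_order all_algebra.
From mathcomp Require Import boolp classical_sets filter.
From mathcomp Require Import realalg.

Set Implicit Arguments.
Unset Strict Implicit.
Unset Printing Implicit Defensive.

Import GRing.Theory Num.Theory.
Import Quotient.

Local Open Scope classical_set_scope.

Definition countably_incomplete (I : Type) (F : set_system I) : Prop :=
  exists A : nat -> set I, (forall n, F (A n)) /\ ~ F (\bigcap_n A n).

Section Ultrapower.
Variables (I : Type) (F : set_system I) (FU : UltraFilter F).

Definition ae_eq (A : Type) (u v : {classic (I -> A)}) : bool :=
  `[< F [set i | u i = v i] >].

Lemma ae_eq_equiv (A : Type) : equiv_class_of (@ae_eq A).
Proof.
split=> [u|u v|v u w].
- apply/asboolP; apply: filterS filterT => i _ //=.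
- by apply/asboolP/asboolP; apply: filterS => i /= ->.
- move=> /asboolP uv /asboolP vw; apply/asboolP.
  by apply: filterS2 uv vw => i /= -> ->.
Qed.

Canonical ae_eq_rel (A : Type) := EquivRelPack (ae_eq_equiv A).

Definition upow (A : Type) := {eq_quot @ae_eq_rel A}%qT.
HB.instance Definition _ (A : Type) := Choice.on (upow A).
HB.instance Definition _ (A : Type) := EqQuotient.on (upow A).

Definition ucls (A : Type) (u : I -> A) : upow A := (\pi_(upow A) u)%qT.

Definition urep (A : Type) (x : upow A) : I -> A := repr x.

Definition star (A : Type) (a : A) : upow A := ucls (fun=> a).

(* An element of upow (A -> B) is an internal function from *A to *B; uapp   *)
(* is its evaluation. In particular star f, for f : A -> B, is the           *)
(* nonstandard extension of f.                                               *)
Definition uapp (A B : Type) (f : upow (A -> B)) (x : upow A) : upow B :=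
  ucls (fun i => urep f i (urep x i)).

Definition uholds (b : upow bool) : bool := `[< F [set i | urep b i] >].

Local Notation "f <@> x" := (uapp f x) (at level 40, left associativity).

Definition hnat := upow nat.
HB.instance Definition _ := Choice.on hnat.
HB.instance Definition _ := EqQuotient.on hnat.

Definition hadd (x y : hnat) : hnat := star addn <@> x <@> y.
Definition hsub (x y : hnat) : hnat := star subn <@> x <@> y.
Definition hmul (x y : hnat) : hnat := star muln <@> x <@> y.
Definition hexp (x y : hnat) : hnat := star expn <@> x <@> y.
Definition hmod (x y : hnat) : hnat := star modn <@> x <@> y.
Definition hmin (x y : hnat) : hnat := star minn <@> x <@> y.
Definition hmax (x y : hnat) : hnat := star maxn <@> x <@> y.
Definition hceil_log2 (x : hnat) : hnat := star (up_log 2) <@> x.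
Definition hle (x y : hnat) : bool := uholds (star leq <@> x <@> y).
Definition hlt (x y : hnat) : bool := uholds (star (fun a b => a < b) <@> x <@> y).
Definition hprime (x : hnat) : bool := uholds (star prime <@> x).

(* Both default to 0 when the extremum does not exist.                       *)
Definition hleast (S : set hnat) : hnat :=
  xget (star 0) [set x | S x /\ forall y, S y -> hle x y].
Definition hgreatest (S : set hnat) : hnat :=
  xget (star 0) [set x | S x /\ forall y, S y -> hle y x].

Definition hceil_root (n : hnat) (i : nat) : hnat :=
  hleast [set r | hle n (hexp r (star i))].

Definition is_cut (C : set hnat) : Prop :=
  forall x y, hle x y -> C y -> C x.

Definition is_subsemiring (C : set hnat) : Prop :=
  [/\ C (star 0), C (star 1),
      forall x y, C x -> C y -> C (hadd x y) &
      forall x y, C x -> C y -> C (hmul x y)].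

Lemma ucls_eq (A : Type) (u v : I -> A) :
  ucls u = ucls v <-> F [set i | u i = v i].
Proof. by split=> [/eqmodP/asboolP//|uv]; apply/eqmodP/asboolP. Qed.

Lemma urepK (A : Type) (x : upow A) : ucls (urep x) = x.
Proof. exact: reprK. Qed.

Lemma urep_cls (A : Type) (u : I -> A) : F [set i | urep (ucls u) i = u i].
Proof. by apply/ucls_eq; rewrite urepK. Qed.

Lemma uappE (A B : Type) (f : I -> A -> B) (u : I -> A) :
  ucls f <@> ucls u = ucls (fun i => f i (u i)).
Proof.
apply/ucls_eq; apply: filterS2 (urep_cls f) (urep_cls u) => i /= -> -> //.
Qed.

Lemma uholdsE (b : I -> bool) : uholds (ucls b) = `[< F [set i | b i] >].
Proof.
apply: asbool_equiv_eq.
by split; apply: filterS2 (urep_cls b) => i /= ->.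
Qed.

Section PrimeField.
Variable p : hnat.

(* Primality is only a parameter of the type so that the field instance can  *)
(* be found by unification.                                                  *)
Record Fp (p_prime : hprime p) := MkFp { Fp_val : hnat; _ : hlt Fp_val p }.

Variable p_prime : hprime p.
Local Notation K := (Fp p_prime).
HB.instance Definition _ := [isSub for @Fp_val p_prime].
HB.instance Definition _ := [Choice of K by <:].

Lemma prime_ae : F [set i | prime (urep p i)].
Proof.
move: p_prime; rewrite -[p in hprime p]urepK /hprime /star uappE uholdsE.
by move/asboolP.
Qed.

Lemma hltE (u : I -> nat) : hlt (ucls u) p <-> F [set i | u i < urep p i].
Proof.
by rewrite -[p in hlt _ p]urepK /hlt /star !uappE uholdsE; split=> /asboolP.
Qed.

Lemma hmodE (u : I -> nat) :
  hmod (ucls u) p = ucls (fun i => u i %% urep p i).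
Proof. by rewrite -[p in hmod _ p]urepK /hmod /star !uappE. Qed.

Lemma hmod_ltp (x : hnat) : hlt (hmod x p) p.
Proof.
rewrite -(urepK x) hmodE; apply/hltE.
by apply: filterS prime_ae => i /= /prime_gt0 ?; rewrite ltn_mod.
Qed.

Definition inFp (x : hnat) : K := MkFp p_prime (hmod_ltp x).

Definition Fadd (x y : K) : K := inFp (hadd (Fp_val x) (Fp_val y)).
Definition Fopp (x : K) : K := inFp (hsub p (Fp_val x)).
Definition Fmul (x y : K) : K := inFp (hmul (Fp_val x) (Fp_val y)).
Definition Finv (x : K) : K :=
  if x == inFp (star 0) then inFp (star 0) else
  inFp (star (fun a q => (egcdn a q).1) <@> Fp_val x <@> p).

Lemma FpP (x : K) :
  exists2 u, x = inFp (ucls u) & F [set i | u i < urep p i].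
Proof.
exists (urep (Fp_val x)); last by apply/hltE; rewrite urepK; exact: (valP x).
apply: val_inj => /=; rewrite hmodE -[LHS]urepK; apply/ucls_eq.
have /hltE : hlt (ucls (urep (Fp_val x))) p by rewrite urepK; exact: (valP x).
by apply: filterS => i /= ?; rewrite modn_small.
Qed.

Lemma inFp_eq (u v : I -> nat) :
  F [set i | u i %% urep p i = v i %% urep p i] <->
  inFp (ucls u) = inFp (ucls v).
Proof.
split=> [uv|/(congr1 val)/=]; last by rewrite !hmodE => /ucls_eq.
by apply: val_inj => /=; rewrite !hmodE; apply/ucls_eq.
Qed.

Lemma FaddE (u v : I -> nat) :
  Fadd (inFp (ucls u)) (inFp (ucls v)) = inFp (ucls (fun i => u i + v i)).
Proof.
rewrite /Fadd /= !hmodE /hadd /star !uappE; apply/inFp_eq.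
by apply: filterS filterT => i _ /=; rewrite modnDm.
Qed.

Lemma FmulE (u v : I -> nat) :
  Fmul (inFp (ucls u)) (inFp (ucls v)) = inFp (ucls (fun i => u i * v i)).
Proof.
rewrite /Fmul /= !hmodE /hmul /star !uappE; apply/inFp_eq.
by apply: filterS filterT => i _ /=; rewrite modnMm.
Qed.

Lemma inFp_elim (P : K -> Prop) :
  (forall u, P (inFp (ucls u))) -> forall x, P x.
Proof. by move=> Pu x; have [u -> _] := FpP x. Qed.

Lemma inFp_ext (u v : I -> nat) :
  (forall i, u i = v i) -> inFp (ucls u) = inFp (ucls v).
Proof. by move=> uv; congr (inFp (ucls _)); apply/funext. Qed.

Lemma FaddA : associative Fadd.
Proof.
elim/inFp_elim=> u; elim/inFp_elim=> v; elim/inFp_elim=> w.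
by rewrite !FaddE; apply: inFp_ext => i; rewrite addnA.
Qed.

Lemma FaddC : commutative Fadd.
Proof.
elim/inFp_elim=> u; elim/inFp_elim=> v.
by rewrite !FaddE; apply: inFp_ext => i; rewrite addnC.
Qed.

Lemma Fadd0 : left_id (inFp (star 0)) Fadd.
Proof. by elim/inFp_elim=> u; rewrite FaddE. Qed.

Lemma FaddN : left_inverse (inFp (star 0)) Fopp Fadd.
Proof.
move=> x; have [u -> up] := FpP x.
have subpE v : hsub p (ucls v) = ucls (fun i => urep p i - v i).
  by rewrite -[p in LHS]urepK /hsub /star !uappE.
rewrite /Fopp /= hmodE subpE FaddE.
apply/inFp_eq; apply: filterS up => i /= up.
by rewrite (modn_small up) subnK 1?ltnW // modnn mod0n.
Qed.

HB.instance Definition _ :=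
  GRing.isZmodule.Build K FaddA FaddC Fadd0 FaddN.

Lemma FmulA : associative Fmul.
Proof.
elim/inFp_elim=> u; elim/inFp_elim=> v; elim/inFp_elim=> w.
by rewrite !FmulE; apply: inFp_ext => i; rewrite mulnA.
Qed.

Lemma FmulC : commutative Fmul.
Proof.
elim/inFp_elim=> u; elim/inFp_elim=> v.
by rewrite !FmulE; apply: inFp_ext => i; rewrite mulnC.
Qed.

Lemma Fmul1 : left_id (inFp (star 1)) Fmul.
Proof.
by elim/inFp_elim=> u; rewrite FmulE; apply: inFp_ext => i; rewrite mul1n.
Qed.

Lemma FmulDl : left_distributive Fmul Fadd.
Proof.
elim/inFp_elim=> u; elim/inFp_elim=> v; elim/inFp_elim=> w.
by rewrite !(FaddE, FmulE); apply: inFp_ext => i; rewrite mulnDl.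
Qed.

Lemma Fone_neq0 : inFp (star 1) != inFp (star 0).
Proof.
apply/eqP=> /inFp_eq H; apply: (@filter_not_empty _ F).
apply: filterS2 prime_ae H => i /= /prime_gt1 pi.
by rewrite !modn_small // ltnW.
Qed.

HB.instance Definition _ :=
  GRing.Zmodule_isComNzRing.Build K FmulA FmulC Fmul1 FmulDl Fone_neq0.

Lemma FmulV (x : K) : (x != 0)%R -> (Finv x * x = 1)%R.
Proof.
have [u -> up] := FpP x => u0.
rewrite -[LHS]/(Fmul _ _) /Finv ifN //=; move/eqP in u0; rewrite hmodE.
have invE v : star (fun a q => (egcdn a q).1) <@> ucls v <@> p =
              ucls (fun i => (egcdn (v i) (urep p i)).1).
  by rewrite -[p in LHS]urepK /star !uappE.
rewrite invE FmulE.
apply/inFp_eq.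
have nz : F [set i | u i != 0].
  have [//|H] := in_ultra_setVsetC [set i | u i != 0] FU.
  exfalso; apply: u0; apply/inFp_eq; apply: filterS H => i /= /negP.
  by rewrite negbK => /eqP ->.
apply: filterS3 prime_ae up nz => i /= pi ui u0i.
rewrite (modn_small ui); case: egcdnP => [|a b ab _ /=]; first by rewrite lt0n.
rewrite ab modnMDl (eqP (_ : coprime (u i) (urep p i))) //.
by rewrite coprime_sym prime_coprime // gtnNdvd // lt0n.
Qed.

Lemma FmulV0 : Finv 0%R = 0%R.
Proof. by rewrite /Finv eqxx. Qed.

HB.instance Definition _ := GRing.ComNzRing_isField.Build K FmulV FmulV0.

Local Open Scope ring_scope.

Definition Fle (a b : K) : Prop := exists x : K, b - a = x ^+ 2.

Definition habs (a : hnat) : hnat := hmin a (hsub p a).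

Definition hentry (M : upow (nat -> nat -> nat)) (a b : hnat) : hnat :=
  M <@> a <@> b.

(* An internal n x n matrix over F_p is the restriction to [n] x [n] of an   *)
(* internal function *N -> *N -> *N whose values there are below p.          *)
Definition internal_mx (n : hnat) (M : upow (nat -> nat -> nat)) : Prop :=
  forall a b, hlt a n -> hlt b n -> hlt (hentry M a b) p.

(* 'F_q is Z/qZ only when q is prime, which suffices since p is prime.       *)
Definition eigenvalue_mod (q n : nat) (M : nat -> nat -> nat) (l : nat) :
    bool :=
  eigenvalue (\matrix_(i < n, j < n) (M i j)%:R : 'M['F_q]_n) l%:R.

Definition heigenvalue (n : hnat) (M : upow (nat -> nat -> nat)) (x : K) :
    bool :=
  uholds (star eigenvalue_mod <@> p <@> n <@> M <@> Fp_val x).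

Definition fQbar (x : K) : hnat :=
  hleast [set v | exists n m k M,
    [/\ hle (star 1%N) n /\ inFp k != 0,
        internal_mx n M,
        forall a b, hlt a n -> hlt b n -> hle (habs (hentry M a b)) m,
        heigenvalue n M (inFp k * x) &
        v = hadd n (hceil_log2 (hmax m k))]].

Definition phi2 (n : hnat) : Prop :=
  forall x y : K, hlt (fQbar x) n -> hlt (fQbar y) n ->
  exists z : K, x ^+ 2 + y ^+ 2 = z ^+ 2.

Definition phi_odd (d : nat) (n : hnat) : Prop :=
  forall a : 'I_d -> K, (forall i, hlt (fQbar (a i)) n) ->
  exists x : K, x ^+ d + \sum_(i < d) a i * x ^+ i = 0.

Definition phi (d : nat) : hnat -> Prop :=
  if d == 2%N then phi2 else phi_odd d.

Definition phi_index (d : nat) : bool := (d == 2%N) || (odd d && (1 < d)%N).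

Definition nhat (d : nat) : hnat := hgreatest [set n | phi d n].

Definition Cp : set hnat :=
  [set x | forall d i : nat, phi_index d -> (1 <= i)%N ->
           hlt x (hceil_root (nhat d) i)].

Definition RC (C : set hnat) : set K := fQbar @^-1` C.

End PrimeField.
End Ultrapower.

Arguments RC {I F FU p} p_prime C.

(* The subset S of K, with the operations of K, is a real-closed field       *)
(* ordered by le: it is the image of a real-closed field under a (necessarily *)
(* injective) ring morphism that transports its order to le.                 *)
Definition is_real_closed_field (K : fieldType) (S : set K)
    (le : K -> K -> Prop) : Prop :=
  exists (R : rcfType) (g : {rmorphism R -> K}),
    range g = S /\ forall x y : R, (x <= y)%R <-> le (g x) (g y).

(* Main.v *)
Require Import Defs.
From HB Require Import structures.
From mathcomp Require Import all_boot all_order all_algebra all_fingroup.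
From mathcomp Require Import all_solvable all_field.
From mathcomp Require Import boolp classical_sets filter.
From mathcomp Require Import polyrcf realalg zify ring lra.

(* An element x of a field has complexity at most N when k x, for some nonzero
   integer k with |k| <= 2^N, is an eigenvalue of an integer matrix of size at
   most N with entries at most 2^N. Sums and products are read off a common
   eigenvector of tensor products of matrices, roots of monic polynomials off a
   block companion matrix, and inverses off the reversed characteristic
   polynomial: all have complexity at most (N + 2)^e, with e depending only on
   the degree of the polynomial. These bounds hold in every F_q, so they transfer
   to the ultraproduct, and f^-1[C] is a subfield of F_p that contains the roots
   in F_p of its monic polynomials. As F_p has no square root of -1, each of its
   elements is plus or minus a square; since C lies below every n_d, sums of
   squares of f^-1[C] are squares and its polynomials of odd degree have roots.
   By Artin-Schreier (the Galois group of a splitting field over such a field is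
   a 2-group, of order at most 2 because every element of a quadratic extension
   is a square), f^-1[C] is real closed.

   C_p is itself a semiring because every n_d is infinite: an element of F_p of
   standard complexity is algebraic over the real algebraic numbers, hence is
   one of them, as F_p contains no square root of -1. *)

Set Implicit Arguments.
Unset Strict Implicit.
Unset Printing Implicit Defensive.

Import Order.TTheory GRing.Theory Num.Theory.
Local Open Scope ring_scope.

(** * Squares and root-free polynomials over finite fields *)

Lemma finField_generator (F : finFieldType) :
  exists g : F, forall x, x != 0 -> exists n, x = g ^+ n.
Proof.
have /cyclicP[g gen] : cyclic [set: {unit F}] by apply: field_unit_group_cyclic.
exists (FinRing.uval g) => x; rewrite -unitfE => Ux.
have /cycleP[n xE] : FinRing.unit F Ux \in <[g]>%g by rewrite -gen inE.
by exists n; rewrite -FinRing.val_unitX -xE.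
Qed.

Lemma finField_sqr_or_opp (F : finFieldType) (x : F) :
  (forall z : F, z ^+ 2 != -1) -> exists y : F, x = y ^+ 2 \/ x = - y ^+ 2.
Proof.
move=> noN1; have [g gen] := finField_generator F.
have [->|/gen[n ->]] := eqVneq x 0; first by exists 0; left; rewrite expr0n.
have [|m N1E] := gen (-1); first by rewrite oppr_eq0 oner_eq0.
have even_sqr k : ~~ odd k -> g ^+ k = (g ^+ k./2) ^+ 2.
  by move=> /even_halfK kE; rewrite -exprM muln2 kE.
have odd_m : odd m.
  by apply: contraT => /even_sqr/esym/eqP; rewrite -N1E (negPf (noN1 _)).
have [odd_n|/even_sqr ->] := boolP (odd n); last by exists (g ^+ n./2); left.
exists (g ^+ (m + n)./2); right.
by rewrite -even_sqr ?oddD ?odd_m ?odd_n // exprD -N1E mulN1r opprK.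
Qed.

Lemma Fp_sum_sqr_not_sqr (q : nat) : prime q -> (forall z : 'F_q, z ^+ 2 != -1) ->
  exists x y : 'F_q, forall z, x ^+ 2 + y ^+ 2 != z ^+ 2.
Proof.
(* Otherwise every natural number is a square, including q - 1. *)
move=> pr_q noN1; apply: contrapT => sum_sqr.
have nat_sqr n : exists z : 'F_q, n%:R = z ^+ 2.
  elim: n => [|n [z zE]]; first by exists 0; rewrite expr0n.
  apply: contrapT => not_sqr; apply: sum_sqr; exists z, 1 => w; apply/eqP => zw.
  by apply: not_sqr; exists w; rewrite -zw -zE expr1n -natr1.
have [z zE] := nat_sqr q.-1; case/eqP: (noN1 z); rewrite -zE.
apply/eqP; rewrite -subr_eq0 opprK natr1 prednK ?prime_gt0 //.
by rewrite pchar_Fp_0.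
Qed.

Lemma finField_rootfree (F : finFieldType) (d : nat) : (1 < d)%N ->
  exists c : F, forall x, x ^+ d - x + c != 0.
Proof.
(* x |-> x - x^d identifies 0 and 1, so that it misses some c. *)
move=> d1; apply: contrapT => all_roots; pose g (x : F) := x - x ^+ d.
have [h hK] : exists h, cancel h g.
  apply: (fin_all_exists (P := fun c x => g x = c)) => c.
  apply: contrapT => noroot; apply: all_roots; exists c => x; apply/eqP => xc.
  by apply: noroot; exists x; rewrite /g -[RHS](subr0 c) -xc; ring.
have [h' hh' h'h] : bijective h := injF_bij (can_inj hK).
have inj_g : injective g by move=> x y; rewrite -(h'h x) -(h'h y) !hK => ->.
have /eqP := oner_neq0 F; apply; apply: inj_g.
by rewrite /g expr1n expr0n eqn0Ngt (ltnW d1) subrr subr0.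
Qed.

(** * Splitting fields *)

Lemma exists_irreducible_factor (F : fieldType) (p : {poly F}) :
  (1 < size p)%N -> exists2 q, irreducible_poly q & q %| p.
Proof.
have [n] := ubnP (size p); elim: n p => // n IHn p; rewrite ltnS => lepn p_gt1.
have [irr|reducible] := pselect (irreducible_poly p); first by exists p.
have [q /andP[q_neq1 qp] nqp] :
    exists2 q : {poly F}, (size q != 1) && (q %| p) & ~~ (q %= p).
  apply: contra_notP reducible => all_trivial; split=> // q q_neq1 qp.
  by apply: contra_notT all_trivial => nqp; exists q; rewrite ?q_neq1.
have p_neq0 : p != 0 by rewrite -size_poly_gt0 ltnW.
have q_neq0 : q != 0 by apply: contraTneq qp => ->; rewrite dvd0p.
have ltqp : (size q < size p)%N.
  by rewrite ltn_neqAle dvdp_leq // andbT dvdp_size_eqp.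
have [||r irr_r rq] := IHn q.
- exact: leq_trans lepn.
- by rewrite ltn_neqAle eq_sym q_neq1 size_poly_gt0.
by exists r => //; apply: dvdp_trans qp.
Qed.

Lemma irreducible_rootE (F : fieldType) (p : {poly F}) (x : F) :
  irreducible_poly p -> root p x -> p = lead_coef p *: ('X - x%:P).
Proof.
move=> [_ irr_p]; rewrite -dvdp_XsubCl => /irr_p; rewrite size_XsubC => /(_ isT).
by move=> /eqp_eq; rewrite (monicP (monicXsubC x)) scale1r => ->.
Qed.

Lemma map_poly_XsubC (A B : nzRingType) (f : {rmorphism A -> B}) (a : A) :
  map_poly f ('X - a%:P) = 'X - (f a)%:P.
Proof. by rewrite rmorphB /= map_polyX map_polyC. Qed.

Lemma exists_splitting_ext (F : fieldType) (p : {poly F}) : p != 0 ->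
  exists (L : fieldExtType F) (zs : seq L),
    map_poly (in_alg L) p %= \prod_(z <- zs) ('X - z%:P).
Proof.
have [n] := ubnP (size p); elim: n => // n IHn in F p *; rewrite ltnS => lepn p0.
have [p_le1|p_gt1] := leqP (size p) 1.
  exists F^o, [::]; rewrite big_nil -size_poly_eq1 size_map_poly.
  by rewrite eqn_leq p_le1 size_poly_gt0.
have [r irr_r /dvdpP[s Ds]] := exists_irreducible_factor p_gt1.
have [K _ [x rx0 _]] := irredp_FAdjoin irr_r.
have /factor_theorem[q Dq] : root (map_poly (in_alg K) p) x.
  by rewrite Ds rmorphM rootM rx0 orbT.
have q0 : q != 0.
  by apply: contraNneq p0 => q0; rewrite -(map_poly_eq0 (in_alg K)) Dq q0 mul0r.
have [|L [zs Dzs]] := IHn K q _ q0.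
  move: lepn; rewrite -(size_map_poly (in_alg K)) Dq.
  by rewrite size_mul ?polyXsubC_eq0 // size_XsubC addn2.
exists (baseFieldType L : fieldExtType F), (in_alg L x :: zs).
have -> : map_poly (in_alg (baseFieldType L : fieldExtType F)) p
          = map_poly (in_alg L) (map_poly (in_alg K) p).
  by rewrite -map_poly_comp; apply: eq_map_poly => a; apply: baseField_scaleE.
by rewrite Dq rmorphM /= big_cons mulrC map_poly_XsubC eqp_mull.
Qed.

Lemma splittingFieldFor_adjoin_seq (F : fieldType) (L : fieldExtType F)
    (p : {poly F}) (zs : seq L) :
  map_poly (in_alg L) p %= \prod_(z <- zs) ('X - z%:P) ->
  let E := [the fieldExtType F of subvs_of <<1 & zs>>%AS] in
  splittingFieldFor 1 (map_poly (in_alg E) p) {:E}.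
Proof.
move=> Dp E; pose ys : seq E := map (vsproj <<1 & zs>>%AS) zs.
have valys : map vsval ys = zs.
  by rewrite -map_comp map_id_in // => z zzs; rewrite /= vsprojK ?seqv_sub_adjoin.
exists ys.
  rewrite -(eqp_map (vsval : {rmorphism E -> L})) -map_poly_comp.
  rewrite rmorph_prod (eq_map_poly (g := in_alg L)) => [|a]; last exact: rmorph_alg.
  apply: eqp_trans Dp _; rewrite -[X in \prod_(z <- X) _]valys big_map.
  rewrite (eq_bigr (fun y : E => map_poly vsval ('X - y%:P))) ?eqpxx // => y _.
  by rewrite [RHS](map_poly_XsubC (vsval : {rmorphism E -> L})).
apply/vspaceP=> u; rewrite memvf; pose f := linfun (vsval : E -> L).
have : f u \in (f @: <<1 & ys>>)%VS.
  have -> : (f @: <<1 & ys>> = <<1 & zs>>)%VS.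
    rewrite (aimg_adjoin_seq (f : 'AHom(E, L))) aimg1 -[in RHS]valys.
    by congr <<1 & _>>%VS; apply: eq_map => y; rewrite lfunE.
  by rewrite lfunE; apply: valP.
by case/memv_imgP=> v ysv; rewrite !lfunE => /val_inj ->.
Qed.

Lemma exists_splitting_field (F : fieldType) (p : {poly F}) : p != 0 ->
  exists L : splittingFieldType F,
    splittingFieldFor 1 (map_poly (in_alg L) p) {:L}.
Proof.
move=> /exists_splitting_ext[L [zs /splittingFieldFor_adjoin_seq split_p]].
pose E := [the fieldExtType F of subvs_of <<1 & zs>>%AS].
have splitE : SplittingField.axiom E.
  by exists (map_poly (in_alg E) p) => //; apply/polyOver1P; exists p.
by exists (HB.pack_for (splittingFieldType F) E
   (FieldExt_isSplittingField.Build F E splitE)).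
Qed.

(** * Quadratic extensions *)

Section QuadraticExtension.
Variables (F : fieldType) (L : fieldExtType F) (K M : {subfield L}).
Hypotheses (sKM : (K <= M)%VS) (dimM : \dim_K M = 2%N).

Lemma quadratic_adjoin_span (y z : L) : y \in M -> y \notin K -> z \in M ->
  exists2 a, a \in K & exists2 b, b \in K & z = a + b * y.
Proof.
move=> yM yK zM.
have sKyM : (<<K; y>> <= M)%VS by apply/FadjoinP.
have deg_gt1 : (1 < adjoin_degree K y)%N.
  rewrite ltn_neqAle eq_sym adjoin_deg_eq1 yK /= adjoin_degreeE.
  by rewrite divn_gt0 ?adim_gt0 // dimvS // subv_adjoin.
have deg2 : adjoin_degree K y = 2%N.
  apply/eqP; rewrite eqn_leq deg_gt1 andbT adjoin_degreeE -dimM.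
  by rewrite leq_div2r // dimvS.
have /Fadjoin_poly_eq <- : z \in <<K; y>>%VS.
  suff -> : <<K; y>>%VS = M by [].
  apply/eqP; rewrite eqEdim sKyM dim_Fadjoin deg2.
  by rewrite (dim_sup_field sKM) dimM leqnn.
have Kcoef := polyOverP (Fadjoin_polyOver K y z).
exists (Fadjoin_poly K y z)`_0 => //; exists (Fadjoin_poly K y z)`_1 => //.
rewrite (@horner_coef_wide _ 2) -?deg2 ?size_Fadjoin_poly // deg2.
by rewrite !big_ord_recr big_ord0 /= expr0 expr1 mulr1 add0r.
Qed.

Lemma quadratic_sqrt_generator : 2%:R != 0 :> L ->
  exists x, [/\ x \in M, x \notin K & x ^+ 2 \in K].
Proof.
move=> two0.
have [y yM yK] : exists2 y, y \in M & y \notin K.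
  apply/subvPn; apply/negP => sMK.
  have eqKM : (K : {vspace L}) = M by apply/eqP; rewrite eqEsubv sKM.
  by move: dimM; rewrite -eqKM divnn adim_gt0.
have [a Ka [b Kb y2]] := quadratic_adjoin_span yM yK (rpredX 2 yM).
have K2 : 2%:R \in K by rewrite rpred_nat.
exists (y - b / 2%:R); split.
- by rewrite rpredB // (subvP sKM) // rpred_div.
- by rewrite rpredBr // rpred_div.
have -> : (y - b / 2%:R) ^+ 2 = a + (b / 2%:R) ^+ 2 by rewrite sqrrB y2; field.
by rewrite rpredD // rpredX // rpred_div.
Qed.

End QuadraticExtension.

(** * Ordered fields with square roots and roots of odd degree polynomials *)

Section OddSqrt.
Local Open Scope group_scope.
Local Open Scope ring_scope.
Variable R : realFieldType.
Hypothesis nonneg_sqrt : forall x : R, 0 <= x -> exists y, y ^+ 2 = x.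
Hypothesis odd_monic_root :
  forall p : {poly R}, p \is monic -> ~~ odd (size p) -> exists x, root p x.

Lemma complex_sqrt (a b : R) :
  exists c d, c ^+ 2 - d ^+ 2 = a /\ c * d *+ 2 = b.
Proof.
have [s s2] := nonneg_sqrt (addr_ge0 (sqr_ge0 a) (sqr_ge0 b)).
pose r := `|s|; have r2 : r ^+ 2 = a ^+ 2 + b ^+ 2 by rewrite real_normK ?num_real.
have : `|a| <= r.
  by rewrite -(@ler_pXn2r _ 2) ?nnegrE ?normr_ge0 //
    real_normK ?num_real // r2 lerDl sqr_ge0.
rewrite ler_norml => /andP[a_ge a_le].
have [|c c2] := nonneg_sqrt (_ : 0 <= (r + a) / 2%:R); first by lra.
have [|d d2] := nonneg_sqrt (_ : 0 <= (r - a) / 2%:R); first by lra.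
have cd : (c * d *+ 2) ^+ 2 = b ^+ 2.
  by rewrite exprMn_n exprMn c2 d2 -(addKr (a ^+ 2) (b ^+ 2)) -r2; field.
have cd_sub : c ^+ 2 - d ^+ 2 = a by rewrite c2 d2; field.
move/eqP: cd; rewrite eqf_sqr => /orP[]/eqP cd; first by exists c, d.
by exists c, (- d); rewrite sqrrN mulrN mulNrn cd opprK.
Qed.

Lemma fieldExt_pchar0 (L : fieldExtType R) : [pchar L] =i pred0.
Proof. by move=> p; rewrite pchar_lalg pchar_num. Qed.

Lemma fieldExt_separable (L : fieldExtType R) (K M : {subfield L}) : separable K M.
Proof.
by apply/separableP => y _; apply: pcharf0_separable (@fieldExt_pchar0 L) _.
Qed.

Lemma fieldExt_two_neq0 (L : fieldExtType R) : 2%:R != 0 :> L.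
Proof. by rewrite ((pcharf0P L).1 (@fieldExt_pchar0 L)). Qed.

Lemma odd_dim_subfield (L : fieldExtType R) (M : {subfield L}) :
  odd (\dim M) -> \dim M = 1%N.
Proof.
move=> oddM; pose x := separable_generator 1 M.
have defM : M = <<1; x>>%VS :> {vspace L}.
  exact: eq_adjoin_separable_generator (fieldExt_separable _ _) (sub1v _).
have degx : \dim M = adjoin_degree 1 x by rewrite defM dim_Fadjoin dimv1 muln1.
have /polyOver1P[p Dp] := minPolyOver 1 x.
have szp : size p = (\dim M).+1.
  by rewrite -(size_map_poly (in_alg L)) -Dp size_minPoly degx.
have [||a pa] := odd_monic_root (p := p).
- by rewrite -(map_monic (in_alg L)) -Dp monic_minPoly.
- by rewrite szp /= oddM.
have dvd : ('X - a%:A%:P) %| minPoly 1 x.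
  by rewrite Dp dvdp_XsubCl [root _ _]fmorph_root.
have := minPoly_irr _ dvd; rewrite polyOverXsubC rpredZ ?mem1v // => /(_ isT).
move=> /orP[] /eqp_size; rewrite size_XsubC ?size_poly1 // size_minPoly degx.
by move=> /esym/eqP; rewrite eqSS => /eqP.
Qed.

Lemma quadratic_sqrtN1 (L : fieldExtType R) (M : {subfield L}) : \dim M = 2%N ->
  exists i, [/\ i \in M, i \notin 1%VS & i ^+ 2 = -1].
Proof.
move=> dimM.
have [|x [xM x1]] := quadratic_sqrt_generator (sub1v M) _ (fieldExt_two_neq0 L).
  by rewrite dimv1 divn1.
case/vlineP=> a x2.
have a_lt0 : a < 0.
  rewrite ltNge; apply/negP => /nonneg_sqrt[y ya].
  move: x1; have /eqP : x ^+ 2 = y%:A ^+ 2 by rewrite x2 -ya exprZn expr1n.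
  by rewrite eqf_sqr => /orP[]/eqP->; rewrite ?rpredN rpredZ // mem1v.
have [|e e2] := nonneg_sqrt (_ : 0 <= - a); first by rewrite oppr_ge0 ltW.
have e0 : e != 0 by rewrite -sqrf_eq0 e2 oppr_eq0 lt_eqF.
exists (e^-1 *: x); split; first by rewrite rpredZ.
  by apply: contra x1 => ex1; rewrite -[x](scalerKV e0) rpredZ.
by rewrite exprZn x2 scalerA exprVn e2 invrN mulNr mulVf ?lt_eqF // scaleN1r.
Qed.

Lemma quadratic_ext_sqrt (L : fieldExtType R) (M : {subfield L}) (z : L) :
  \dim M = 2%N -> z \in M -> exists2 w, w \in M & w ^+ 2 = z.
Proof.
move=> dimM zM; have [i [iM i1 i2]] := quadratic_sqrtN1 dimM.
have [|_ /vlineP[a ->] [_ /vlineP[b ->] ->]] :=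
  quadratic_adjoin_span (sub1v M) _ iM i1 zM; first by rewrite dimv1 divn1.
have [c [d [<- <-]]] := complex_sqrt a b.
exists (c%:A + d%:A * i); first by rewrite rpredD ?rpredM ?rpredZ ?mem1v.
have sqrE (f : {rmorphism R -> L}) :
    (f c + f d * i) ^+ 2 = f (c ^+ 2 - d ^+ 2) + f (c * d *+ 2) * i.
  by rewrite sqrrD exprMn i2 rmorphB rmorphMn rmorphM !rmorphXn; ring.
exact: (sqrE (in_alg L)).
Qed.

Section GaloisDegree.
Variable L : splittingFieldType R.
Local Notation G := 'Gal({:L} / 1).

Lemma galois_over_base : galois 1 {:L}.
Proof. by rewrite /galois sub1v normalFieldf fieldExt_separable. Qed.

Lemma dim_fixedField (H : {group gal_of {:L}}) :
  H \subset G -> \dim (fixedField H) = #|G : H|.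
Proof.
by move=> sHG; rewrite -(dim_fixed_galois galois_over_base sHG) dimv1 divn1.
Qed.

Lemma galois_pgroup2 : 2.-group G.
Proof.
have [H sylH] := Sylow_exists 2 'Gal({:L} / 1)%G.
have sHG := pHall_sub sylH.
have indexH : #|G : H| = 1%N.
  rewrite -dim_fixedField //; apply: odd_dim_subfield.
  by rewrite dim_fixedField // odd_2'nat; case/and3P: sylH.
by rewrite -(index1g sHG indexH) (pHall_pgroup sylH).
Qed.

Lemma splittingField_dim_le2 : (\dim {:L} <= 2)%N.
Proof.
have -> : \dim {:L} = #|G| by rewrite -(galois_dim galois_over_base) dimv1 divn1.
rewrite (card_pgroup galois_pgroup2).
case logG: (logn _ _) => [|[|k]] //.
have [|H1 [sH1G _ oH1]] := normal_pgroup (r := k.+1) galois_pgroup2 (normal_refl _).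
  by rewrite logG.
have [|H2 [sH21 _ oH2]] :=
  normal_pgroup (r := k) (pgroupS sH1G galois_pgroup2) (normal_refl _).
  by rewrite oH1 pfactorK.
have cardG : #|G| = (2 ^ k.+2)%N by rewrite (card_pgroup galois_pgroup2) logG.
have dim1 : \dim (fixedField H1) = 2%N.
  by rewrite dim_fixedField // -divgS // cardG oH1 expnS mulnK // expn_gt0.
have dim2 : \dim (fixedField H2) = 4%N.
  rewrite dim_fixedField ?(fintype.subset_trans sH21) //.
  rewrite -divgS ?(fintype.subset_trans sH21) // cardG oH2.
  by rewrite !expnS mulnA mulnK // expn_gt0.
have [|x [x2 /negP x1]] :=
  quadratic_sqrt_generator (fixedFieldS sH21) _ (fieldExt_two_neq0 L).
  by rewrite dim1 dim2.
move=> /(quadratic_ext_sqrt dim1)[w w1 /esym/eqP].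
by rewrite eqf_sqr => wx; case: x1; case/orP: wx => /eqP->; rewrite ?rpredN.
Qed.

End GaloisDegree.

Lemma irreducible_size_le3 (p : {poly R}) : irreducible_poly p -> (size p <= 3)%N.
Proof.
move=> irr_p; have [L [zs Dp defL]] := exists_splitting_field (irredp_neq0 irr_p).
have [x xzs] : exists x, x \in zs.
  case: zs Dp {defL} => [|x zs _]; last by exists x; rewrite inE eqxx.
  rewrite big_nil -size_poly_eq1 size_map_poly => /eqP p1.
  by case: irr_p; rewrite p1.
have px : root (map_poly (in_alg L) p) x by rewrite (eqp_root Dp) root_prod_XsubC.
have /polyOver1P[q Dq] := minPolyOver 1 x.
have pL : map_poly (in_alg L) p \is a polyOver 1%AS by apply/polyOver1P; exists p.
have := minPoly_dvdp pL px.
rewrite Dq dvdp_map => /(irr_p.2 q).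
have szq : size q = (adjoin_degree 1 x).+1.
  by rewrite -(size_map_poly (in_alg L)) -Dq size_minPoly.
rewrite szq eqSS => /(_ isT)/eqp_size <-; rewrite szq ltnS.
rewrite adjoin_degreeE dimv1 divn1; apply: leq_trans (splittingField_dim_le2 L).
exact/dimvS/subvf.
Qed.

Lemma irreducible_linear_or_quadratic (p : {poly R}) : irreducible_poly p ->
  exists c a : R, c != 0 /\
    (p = c *: ('X - a%:P) \/
     exists2 b : R, b != 0 & p = c *: (('X - a%:P) ^+ 2 + (b ^+ 2)%:P)).
Proof.
move=> irr_p; have c0 : lead_coef p != 0 by rewrite lead_coef_eq0 irredp_neq0.
have [[a pa]|noroot] := pselect (exists a, root p a).
  by exists (lead_coef p), a; split=> //; left; apply: irreducible_rootE.
have szp : size p = 3%N.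
  have := irreducible_size_le3 irr_p; rewrite leq_eqVlt => /orP[/eqP //|szp].
  have [|a pa] := @poly2_root _ p; last by case: noroot; exists a.
  by apply/eqP; rewrite eqn_leq -ltnS szp; case: irr_p.
have two0 : 2%:R != 0 :> R by rewrite pnatr_eq0.
have := deg2_poly_canonical two0 szp.
set c := p`_2; set delta := _ - _ * c * _ => pE.
have cE : lead_coef p = c by rewrite lead_coefE szp.
have delta_lt0 : delta < 0.
  rewrite ltNge; apply/negP => /nonneg_sqrt[s s2].
  by case: noroot; eexists; apply: (deg2_poly_root1 two0 szp s2).
have [|b b2] := nonneg_sqrt (_ : 0 <= - (delta / (4%:R * c ^+ 2))).
  by rewrite oppr_ge0 mulr_le0_ge0 ?(ltW delta_lt0) // invr_ge0 mulr_ge0 ?sqr_ge0.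
rewrite cE in c0; exists c, (- (p`_1 / (2%:R * c))); split=> //; right; exists b.
  rewrite -sqrf_eq0 b2 oppr_eq0 mulf_neq0 ?(lt_eqF delta_lt0) // invr_eq0.
  by rewrite mulf_neq0 ?expf_neq0 ?pnatr_eq0.
by rewrite [LHS]pE b2 !polyCN opprK.
Qed.

Lemma linear_quadratic_ind (P : {poly R} -> Prop) :
  (forall c : R, c != 0 -> P c%:P) ->
  (forall p (a : R), P p -> P (p * ('X - a%:P))) ->
  (forall p (a b : R), b != 0 -> P p -> P (p * (('X - a%:P) ^+ 2 + (b ^+ 2)%:P))) ->
  forall p, p != 0 -> P p.
Proof.
move=> Pconst Plinear Pquadratic p; have [n] := ubnP (size p).
elim: n p => // n IHn p; rewrite ltnS => lepn p0.
have [p_le1|p_gt1] := leqP (size p) 1.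
  have pE := size1_polyC p_le1; rewrite pE in p0 *.
  by apply: Pconst; rewrite -polyC_eq0.
have [q irr_q /dvdpP[r Dr]] := exists_irreducible_factor p_gt1.
have [c [a [c0 qE]]] := irreducible_linear_or_quadratic irr_q.
have r0 : r != 0 by apply: contraNneq p0 => r0; rewrite Dr r0 mul0r.
have Pcr : P (c *: r).
  apply: IHn; last by rewrite scaler_eq0 negb_or c0.
  rewrite size_scale //; apply: leq_trans lepn.
  rewrite Dr size_mul ?(irredp_neq0 irr_q) //; case: irr_q => q_gt1 _.
  by rewrite -(subnK q_gt1) addn2 !addnS ltnS leq_addr.
case: qE Dr => [->|[b b0 ->]] ->; rewrite -scalerAr scalerAl; first exact: Plinear.
exact: Pquadratic.
Qed.

Lemma rootfree_same_sign (p : {poly R}) (a b : R) : a <= b -> p != 0 ->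
  (forall x, a <= x <= b -> ~~ root p x) -> 0 < p.[a] * p.[b].
Proof.
move=> leab.
elim/linear_quadratic_ind: p / => [c c0 _|p e IHp noroot|p e f f0 IHp noroot].
- by rewrite !hornerC -expr2 lt0r sqrf_eq0 c0 sqr_ge0.
- have p_pos : 0 < p.[a] * p.[b].
    by apply: IHp => x /noroot; rewrite rootM negb_or => /andP[].
  rewrite !hornerM mulrACA mulr_gt0 // !hornerXsubC.
  have : ~~ (a <= e <= b).
    by apply/negP => /noroot/negP; apply; rewrite rootM root_XsubC eqxx orbT.
  by rewrite negb_and -!ltNge => /orP[]; nra.
have p_pos : 0 < p.[a] * p.[b].
  by apply: IHp => x /noroot; rewrite rootM negb_or => /andP[].
have pos x : 0 < (('X - e%:P) ^+ 2 + (f ^+ 2)%:P).[x].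
  by rewrite !hornerE ltr_wpDl ?sqr_ge0 // lt0r sqrf_eq0 f0 sqr_ge0.
by rewrite !hornerM mulrACA mulr_gt0 // mulr_gt0.
Qed.

Lemma odd_sqrt_real_closed : Num.real_closed_axiom R.
Proof.
move=> p a b leab /andP[pa pb].
have [->|p0] := eqVneq p 0; first by exists a; rewrite ?lexx ?leab ?root0.
apply: contrapT => noroot.
have : 0 < p.[a] * p.[b].
  apply: rootfree_same_sign => // x axb; apply/negP => px.
  by apply: noroot; exists x.
by rewrite ltNge mulr_le0_ge0.
Qed.

Lemma sqr_neqN1_algebraic_image (K : fieldType) (h : {rmorphism R -> K})
    (p : {poly R}) (y : K) :
  (forall z : K, z ^+ 2 != -1) -> p != 0 -> root (map_poly h p) y ->
  exists x, y = h x.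
Proof.
move=> noN1; elim/linear_quadratic_ind: p / => [c c0|p a IHp|p a b b0 IHp].
- by rewrite map_polyC rootC fmorph_eq0 (negPf c0).
- rewrite rmorphM /= rootM map_poly_XsubC root_XsubC => /orP[/IHp //|/eqP ->].
  by exists a.
rewrite rmorphM /= rootM => /orP[/IHp //|].
rewrite rmorphD rmorphXn /= map_poly_XsubC map_polyC /= /root !hornerE addr_eq0.
move=> /eqP sqrE; case/eqP: (noN1 ((y - h a) / h b)).
by rewrite expr_div_n sqrE rmorphXn mulNr divff // expf_neq0 // fmorph_eq0.
Qed.

End OddSqrt.

Local Open Scope classical_set_scope.
Local Open Scope ring_scope.

Definition pair_fun (T : Type) (x y : T) (j : 'I_2) : T := if j == 0 then x else y.

Lemma pair_funP (T : Type) (P : T -> Prop) x y :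
  P x -> P y -> forall j, P (pair_fun x y j).
Proof. by move=> Px Py j; rewrite /pair_fun; case: ifP. Qed.

(** * Relatively algebraically closed subfields *)

Section RelativelyClosedSubfield.
Variables (K : fieldType) (S : set K).
Hypothesis S1 : S 1.
Hypothesis SB : forall x y, S x -> S y -> S (x - y).
Hypothesis SV : forall x y, S x -> S y -> S (x / y).
Hypothesis S_monic_root : forall (d : nat) (a : 'I_d -> K) x, (0 < d)%N ->
  (forall i, S (a i)) -> x ^+ d + \sum_(i < d) a i * x ^+ i = 0 -> S x.
Hypothesis sqr_neqN1 : forall x : K, x ^+ 2 != -1.
Hypothesis sqr_or_opp : forall x : K, exists y, x = y ^+ 2 \/ x = - y ^+ 2.
Hypothesis S_sum_sqr :
  forall x y, S x -> S y -> exists z : K, x ^+ 2 + y ^+ 2 = z ^+ 2.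
Hypothesis S_odd_solvable : forall (d : nat) (a : 'I_d -> K), odd d -> (1 < d)%N ->
  (forall i, S (a i)) -> exists x, x ^+ d + \sum_(i < d) a i * x ^+ i = 0.

Definition subfield_pred : {pred K} := fun x => `[< S x >].

Lemma subfield_divring_closed : divring_closed subfield_pred.
Proof.
split; first exact/asboolP.
- by move=> x y /asboolP Sx /asboolP Sy; apply/asboolP/SB.
- by move=> x y /asboolP Sx /asboolP Sy; apply/asboolP/SV.
Qed.

HB.instance Definition _ :=
  GRing.isDivringClosed.Build K subfield_pred subfield_divring_closed.

Record subfield_type :=
  MkSubfield { subfield_val : K; _ : subfield_val \in subfield_pred }.
Local Notation T := subfield_type.

HB.instance Definition _ := [isSub for subfield_val].
HB.instance Definition _ := [Choice of T by <:].
HB.instance Definition _ := [SubChoice_isSubComUnitRing of T by <:].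
HB.instance Definition _ := [SubComUnitRing_isSubIntegralDomain of T by <:].
HB.instance Definition _ := [SubIntegralDomain_isSubField of T by <:].

Lemma subfieldP (x : T) : S (val x).
Proof. by apply/asboolP; apply: (valP x). Qed.

Lemma subfield_surj (x : K) : S x -> exists y : T, val y = x.
Proof. by move=> /asboolP Sx; exists (MkSubfield Sx). Qed.

Definition sqle (x y : T) : bool := `[< exists z : K, val y - val x = z ^+ 2 >].

Lemma sqle0P (x : T) : reflect (exists y : T, x = y ^+ 2) (sqle 0 x).
Proof.
apply: (iffP idP) => [/asboolP[z]|[y ->]]; last first.
  by apply/asboolP; exists (val y); rewrite !rmorphE subr0.
rewrite rmorph0 subr0 => xz.
have S0 : S 0 by rewrite -(subrr 1); apply: SB.
have Sz : S z.
  apply: (@S_monic_root 2 (pair_fun (0 - val x) 0)) => //.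
    by apply: pair_funP => //; apply: SB => //; apply: subfieldP.
  by rewrite !big_ord_recl big_ord0 /pair_fun /= xz; ring.
have [y yz] := subfield_surj Sz.
by exists y; apply: val_inj; rewrite rmorphXn /= yz.
Qed.

Lemma sqle_sub (x y : T) : sqle 0 (y - x) = sqle x y.
Proof. by rewrite /sqle rmorph0 subr0 rmorphB. Qed.

Lemma sqle0_total (x : T) : sqle 0 x || sqle x 0.
Proof.
have [y [xy|xy]] := sqr_or_opp (val x); apply/orP; [left|right]; apply/asboolP.
  by exists y; rewrite rmorph0 subr0.
by exists y; rewrite rmorph0 sub0r xy opprK.
Qed.

Lemma sqle0_anti (x : T) : sqle 0 x -> sqle x 0 -> x = 0.
Proof.
move=> /asboolP[y]; rewrite rmorph0 subr0 => xy /asboolP[z].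
rewrite rmorph0 sub0r xy => yz; apply: val_inj; rewrite rmorph0 xy.
have [z0|z0] := eqVneq z 0; first by rewrite -[LHS]opprK yz z0 expr0n oppr0.
case/eqP: (sqr_neqN1 (y / z)).
by rewrite expr_div_n -[y ^+ 2]opprK yz mulNr divff // expf_neq0.
Qed.

Lemma sqle0_add (x y : T) : sqle 0 x -> sqle 0 y -> sqle 0 (x + y).
Proof.
move=> /sqle0P[u ->] /sqle0P[v ->].
have [z uvz] := S_sum_sqr (subfieldP u) (subfieldP v).
by apply/asboolP; exists z; rewrite rmorph0 subr0 -uvz !rmorphE.
Qed.

Lemma sqle0_mul (x y : T) : sqle 0 x -> sqle 0 y -> sqle 0 (x * y).
Proof.
by move=> /sqle0P[u ->] /sqle0P[v ->]; apply/sqle0P; exists (u * v); rewrite exprMn.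
Qed.

Definition sqnorm (x : T) : T := if sqle 0 x then x else - x.

Lemma sqnormN (x : T) : sqnorm (- x) = sqnorm x.
Proof.
have leN : sqle 0 (- x) = sqle x 0 by rewrite -sub0r sqle_sub.
rewrite /sqnorm leN opprK; have := sqle0_total x; have := @sqle0_anti x.
case: (sqle 0 x); case: (sqle x 0) => //= anti _.
by rewrite anti // oppr0.
Qed.

Lemma ge0_sqnorm (x : T) : sqle 0 x -> sqnorm x = x.
Proof. by rewrite /sqnorm => ->. Qed.

HB.instance Definition _ := Num.IntegralDomain_isLeReal.Build T
  sqle0_add sqle0_mul sqle0_anti sqle_sub sqle0_total sqnormN ge0_sqnorm
  (fun x y => erefl ((y != x) && sqle x y)).

Lemma subfield_sqrt (x : T) : 0 <= x -> exists y : T, y ^+ 2 = x.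
Proof. by move=> /sqle0P[y ->]; exists y. Qed.

Lemma subfield_odd_monic_root (p : {poly T}) :
  p \is monic -> ~~ odd (size p) -> exists x, root p x.
Proof.
move=> mon_p; have p0 := monic_neq0 mon_p.
have szp : size p = (size p).-1.+1 by rewrite prednK // size_poly_gt0.
set d := (size p).-1 in szp *; rewrite szp /= negbK => odd_d.
have [d_gt1|d_le1] := ltnP 1 d; last first.
  have [|x px] := @poly2_root _ p; last by exists x.
  by rewrite szp; case: (d) odd_d d_le1 => [|[]].
have Sp i : S (val p`_i) := subfieldP p`_i.
have [x x0] :=
  S_odd_solvable (a := fun i : 'I_d => val p`_i) odd_d d_gt1 (fun=> Sp _).
have [t tx] := subfield_surj (S_monic_root (ltnW d_gt1) (fun=> Sp _) x0).
have pE : p.[t] = t ^+ d + \sum_(i < d) p`_i * t ^+ i.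
  by rewrite horner_coef szp big_ord_recr /= -lead_coefE (monicP mon_p) mul1r addrC.
exists t; apply/eqP/val_inj; rewrite pE rmorphD rmorphXn rmorph_sum rmorph0.
rewrite -[RHS]x0 -tx.
by congr (_ + _); apply: eq_bigr => i _; rewrite rmorphM rmorphXn.
Qed.

HB.instance Definition _ := Num.RealField_isClosed.Build T
  (odd_sqrt_real_closed subfield_sqrt subfield_odd_monic_root).

Theorem relatively_closed_subfield_real_closed :
  is_real_closed_field S (fun a b => exists x, b - a = x ^+ 2).
Proof.
exists (T : rcfType), (val : {rmorphism T -> K}); split.
  apply/seteqP; split=> [_ [x _ <-]|x /subfield_surj[y <-]]; first exact: subfieldP.
  by exists y.
by move=> x y; split=> [/asboolP|?]; [|apply/asboolP].
Qed.

End RelativelyClosedSubfield.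

(** * Eigenvalues of small integer matrices *)

Section Eigenfunction.
Variable R : comNzRingType.

Definition is_eigenfun (T : finType) (v : T -> R) (A : T -> T -> int) (l : R) :
    Prop :=
  forall t, \sum_s v s * (A s t)%:~R = l * v t.

Section Operations.
Variables (T : finType) (v : T -> R).

Lemma is_eigenfunD A B a b : is_eigenfun v A a -> is_eigenfun v B b ->
  is_eigenfun v (fun s t => A s t + B s t) (a + b).
Proof.
move=> vA vB t; rewrite mulrDl -vA -vB -big_split /=.
by apply: eq_bigr => s _; rewrite rmorphD mulrDr.
Qed.

Lemma is_eigenfunZ c A a :
  is_eigenfun v A a -> is_eigenfun v (fun s t => c * A s t) (c%:~R * a).
Proof.
move=> vA t; rewrite -mulrA -vA mulr_sumr.
by apply: eq_bigr => s _; rewrite rmorphM mulrCA.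
Qed.

Lemma is_eigenfunM A B a b : is_eigenfun v A a -> is_eigenfun v B b ->
  is_eigenfun v (fun s t => \sum_u A s u * B u t) (a * b).
Proof.
move=> vA vB t; rewrite -mulrA -vB mulr_sumr.
under [RHS]eq_bigr => u _ do rewrite mulrA -vA mulr_suml.
rewrite exchange_big; apply: eq_bigr => s _ /=.
by rewrite rmorph_sum mulr_sumr; apply: eq_bigr => u _; rewrite rmorphM mulrA.
Qed.

End Operations.

Lemma is_eigenfun_tensorl (T U : finType) (v : T -> R) (w : U -> R) A a :
  is_eigenfun v A a ->
  is_eigenfun (fun p => v p.1 * w p.2) (fun p q => A p.1 q.1 * (p.2 == q.2)%:R) a.
Proof.
move=> vA [t u] /=; rewrite mulrA -vA mulr_suml.
rewrite -(pair_bigA _ (fun s u' => v s * w u' * (A s t * (u' == u)%:R)%:~R)) /=.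
apply: eq_bigr => s _; rewrite (bigD1 u) //= eqxx mulr1 mulrAC big1 ?addr0 //.
by move=> u' /negPf ->; rewrite !mulr0.
Qed.

Lemma is_eigenfun_tensorr (T U : finType) (v : T -> R) (w : U -> R) B b :
  is_eigenfun w B b ->
  is_eigenfun (fun p => v p.1 * w p.2) (fun p q => (p.1 == q.1)%:R * B p.2 q.2) b.
Proof.
move=> wB [t u] /=; rewrite mulrCA -wB mulr_sumr.
rewrite -(pair_bigA _ (fun s u' => v s * w u' * ((s == t)%:R * B u' u)%:~R)) /=.
rewrite exchange_big; apply: eq_bigr => u' _ /=.
rewrite (bigD1 t) //= eqxx mul1r -mulrA big1 ?addr0 //.
by move=> s /negPf ->; rewrite mul0r mulr0.
Qed.

(* The linearization of the matrix polynomial [c y^d + \sum_i B_i y^i], whose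
   eigenvalue is [c y] rather than [y]: the factor [c] below the diagonal spares
   the powers of [c] needed to make the polynomial monic. *)
Definition block_companion (d : nat) (T : finType) (c : int)
    (B : 'I_d -> T -> T -> int) (p q : 'I_d * T) : int :=
  if (q.1.+1 < d)%N then c * ((p.1 == q.1.+1 :> nat) && (p.2 == q.2))%:R
  else - B p.1 p.2 q.2.

Lemma is_eigenfun_companion d (T : finType) c (B : 'I_d -> T -> T -> int)
    (b : 'I_d -> R) (v : T -> R) (y : R) :
  (forall i, is_eigenfun v (B i) (b i)) ->
  c%:~R * y ^+ d + \sum_(i < d) b i * y ^+ i = 0 ->
  is_eigenfun (fun p : 'I_d * T => y ^+ p.1 * v p.2)
    (block_companion c B) (c%:~R * y).
Proof.
move=> vB y0 [l t]; rewrite /block_companion /=; have [ld|ld] := ltnP l.+1 d.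
  rewrite (bigD1 (Ordinal ld, t)) //= !eqxx mulr1 big1 ?addr0 => [|[i s] /= ne].
    by rewrite exprS; ring.
  rewrite [X in nat_of_bool X](_ : _ = false) ?mulr0 //.
  apply: contraNF ne => /andP[/eqP il /eqP ->].
  by apply/eqP; congr (_, _); apply: val_inj.
have dE : d = l.+1 by apply/eqP; rewrite eqn_leq ltn_ord andbT.
rewrite -(pair_bigA _ (fun (i : 'I_d) s => y ^+ i * v s * (- B i s t)%:~R)) /=.
transitivity (- (\sum_(i < d) b i * y ^+ i) * v t); last first.
  by move/eqP: y0; rewrite addr_eq0 => /eqP <-; rewrite [in LHS]dE exprS; ring.
rewrite mulNr mulr_suml -sumrN; apply: eq_bigr => i _.
rewrite mulrAC -vB mulr_suml -sumrN; apply: eq_bigr => s _.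
by rewrite rmorphN; ring.
Qed.

End Eigenfunction.

Section Complexity.
Variable F : fieldType.
Implicit Types (x y : F) (N : nat).

Definition small_eigenfun N (T : finType) (v : T -> F) x : Prop :=
  exists (k : int) (A : T -> T -> int),
    [/\ `|k| <= 2 ^+ N, k%:~R != 0 :> F, forall s t, `|A s t| <= 2 ^+ N
      & is_eigenfun v A (k%:~R * x)].

Definition has_complexity N x : Prop :=
  exists (T : finType) (v : T -> F),
    [/\ (#|T| <= N)%N, exists t, v t != 0 & small_eigenfun N v x].

Lemma ler_exp2n N N' : (N <= N')%N -> 2 ^+ N <= 2 ^+ N' :> int.
Proof. by move=> leN; rewrite ler_weXn2l. Qed.

Lemma ler_normM_exp2 m n (a b : int) :
  `|a| <= 2 ^+ m -> `|b| <= 2 ^+ n -> `|a * b| <= 2 ^+ (m + n).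
Proof. by move=> am bn; rewrite normrM exprD ler_pM. Qed.

Lemma has_complexityP N x : has_complexity N x <->
  exists n (k : int) (M : 'M[int]_n),
    [/\ (n <= N)%N, `|k| <= 2 ^+ N, k%:~R != 0 :> F,
        forall i j, `|M i j| <= 2 ^+ N
      & eigenvalue (map_mx intr M : 'M[F]_n) (k%:~R * x)].
Proof.
split=> [[T [v [cardT [t0 v0] [k [A [kN k0 AN vA]]]]]]|].
  exists #|T|, k, (\matrix_(i, j) A (enum_val i) (enum_val j)); split=> //.
    by move=> i j; rewrite mxE.
  apply/eigenvalueP; exists (\row_i v (enum_val i)).
    apply/rowP => j; rewrite !mxE -vA (reindex _ (onW_bij _ (enum_val_bij T))) /=.
    by apply: eq_bigr => i _; rewrite !mxE.
  apply: contraNneq v0 => /rowP/(_ (enum_rank t0)).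
  by rewrite !mxE enum_rankK => ->.
move=> [n [k [M [nN kN k0 MN /eigenvalueP[v /rowP vM /rV0Pn[t v0]]]]]].
exists 'I_n, (v 0); split; first by rewrite card_ord.
  by exists t.
exists k, (fun i j => M i j); split=> // j.
by have := vM j; rewrite !mxE => <-; apply: eq_bigr => i _; rewrite !mxE.
Qed.

Lemma small_eigenfunW N N' (T : finType) (v : T -> F) x :
  (N <= N')%N -> small_eigenfun N v x -> small_eigenfun N' v x.
Proof.
move=> /ler_exp2n leN [k [A [kN k0 AN vA]]]; exists k, A; split=> //.
- exact: le_trans leN.
- by move=> s t; apply: le_trans leN.
Qed.

Lemma has_complexityW N N' x :
  (N <= N')%N -> has_complexity N x -> has_complexity N' x.
Proof.
move=> leN [T [v [cardT v0 vx]]]; exists T, v; split=> //.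
- exact: leq_trans leN.
- exact: small_eigenfunW vx.
Qed.

Lemma common_eigenfun N d (a : 'I_d -> F) : (forall i, has_complexity N (a i)) ->
  exists (T : finType) (v : T -> F),
    [/\ (#|T| <= N ^ d)%N, exists t, v t != 0
      & forall i, small_eigenfun N v (a i)].
Proof.
elim: d a => [|d IHd] a a_le.
  exists unit, (fun=> 1); split=> [||[] //]; first by rewrite card_unit.
  by exists tt; rewrite oner_eq0.
have [T [v [cardT [t v0] va]]] := IHd _ (fun i => a_le (lift ord0 i)).
have [U [w [cardU [u w0] [k [B [kN k0 BN wB]]]]]] := a_le ord0.
exists (T * U)%type, (fun p => v p.1 * w p.2); split.
- by rewrite card_prod mulnC expnS leq_mul.
- by exists (t, u); rewrite mulf_neq0.
have le_bool (b : bool) (z : int) : `|z| <= 2 ^+ N -> `|z * b%:R| <= 2 ^+ N.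
  by case: b => zN; rewrite ?mulr1 // mulr0 normr0 exprn_ge0.
move=> i; case: (unliftP ord0 i) => [j|] ->.
  have [l [A [lN l0 AN vA]]] := va j.
  exists l, (fun p q => A p.1 q.1 * (p.2 == q.2)%:R); split=> //.
    by move=> p q; apply: le_bool.
  exact: is_eigenfun_tensorl.
exists k, (fun p q => (p.1 == q.1)%:R * B p.2 q.2); split=> //.
  by move=> p q; rewrite mulrC; apply: le_bool.
exact: is_eigenfun_tensorr.
Qed.

Lemma common_eigenfun2 N x y : has_complexity N x -> has_complexity N y ->
  exists (T : finType) (v : T -> F),
    [/\ (#|T| <= N ^ 2)%N, exists t, v t != 0,
        small_eigenfun N v x & small_eigenfun N v y].
Proof.
move=> xN yN.
have [T [v [cardT v0 vxy]]] := common_eigenfun (pair_funP xN yN).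
by exists T, v; split=> //; [apply: (vxy 0)|apply: (vxy 1)].
Qed.

Lemma has_complexity_int N (z : int) : (0 < N)%N -> `|z| <= 2 ^+ N ->
  has_complexity N (z%:~R : F).
Proof.
move=> N_gt0 zN; exists unit, (fun=> 1); split; first by rewrite card_unit.
  by exists tt; rewrite oner_eq0.
exists 1, (fun _ _ => z); split=> // [||[]].
- by rewrite normr1 exprn_ege1.
- by rewrite oner_eq0.
by rewrite big_const card_unit /= addr0 !mul1r mulr1.
Qed.

Lemma has_complexityD N x y :
  has_complexity N x -> has_complexity N y -> has_complexity (N.+2 ^ 2) (x + y).
Proof.
move=> xN yN; have [T [v [cardT v0 vx vy]]] := common_eigenfun2 xN yN.
have [k [A [kN k0 AN vA]]] := vx; have [l [B [lN l0 BN vB]]] := vy.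
exists T, v; split=> //; first by nia.
apply: (@small_eigenfunW (N + N).+1); first by nia.
exists (k * l), (fun s t => l * A s t + k * B s t); split.
- exact: le_trans (ler_normM_exp2 kN lN) (ler_exp2n (leqnSn _)).
- by rewrite rmorphM mulf_neq0.
- move=> s t; apply: le_trans (ler_normD _ _) _.
  by rewrite exprS mulrDl mul1r lerD // ler_normM_exp2.
have -> : (k * l)%:~R * (x + y) = l%:~R * (k%:~R * x) + k%:~R * (l%:~R * y).
  by rewrite rmorphM /=; ring.
by apply: is_eigenfunD; apply: is_eigenfunZ.
Qed.

Lemma has_complexityM N x y :
  has_complexity N x -> has_complexity N y -> has_complexity (N.+2 ^ 2) (x * y).
Proof.
move=> xN yN; have [T [v [cardT v0 vx vy]]] := common_eigenfun2 xN yN.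
have [k [A [kN k0 AN vA]]] := vx; have [l [B [lN l0 BN vB]]] := vy.
exists T, v; split=> //; first by nia.
apply: (@small_eigenfunW (#|T| + (N + N))); first by nia.
exists (k * l), (fun s t => \sum_u A s u * B u t); split.
- exact: le_trans (ler_normM_exp2 kN lN) (ler_exp2n (leq_addl _ _)).
- by rewrite rmorphM mulf_neq0.
- move=> s t; apply: le_trans (ler_norm_sum _ _ _) _.
  apply: le_trans (_ : \sum_(u : T) 2 ^+ (N + N) <= _).
    by apply: ler_sum => u _; apply: ler_normM_exp2.
  rewrite sumr_const -[leLHS]mulr_natl [in leRHS]exprD ler_wpM2r ?exprn_ge0 //.
  by rewrite -natrX ler_nat ltnW // ltn_expl.
have -> : (k * l)%:~R * (x * y) = k%:~R * x * (l%:~R * y).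
  by rewrite rmorphM /=; ring.
exact: is_eigenfunM.
Qed.

Lemma has_complexity_companion N d (T : finType) (v : T -> F) (c : int)
    (B : 'I_d -> T -> T -> int) (b : 'I_d -> F) y :
  (0 < d)%N -> (d * #|T| <= N)%N -> (exists t, v t != 0) ->
  `|c| <= 2 ^+ N -> c%:~R != 0 :> F -> (forall i s t, `|B i s t| <= 2 ^+ N) ->
  (forall i, is_eigenfun v (B i) (b i)) ->
  c%:~R * y ^+ d + \sum_(i < d) b i * y ^+ i = 0 -> has_complexity N y.
Proof.
move=> d_gt0 cardT [t v0] cN c0 BN vB y0.
exists ('I_d * T)%type, (fun p : 'I_d * T => y ^+ p.1 * v p.2); split.
- by rewrite card_prod card_ord.
- by exists (Ordinal d_gt0, t); rewrite expr0 mul1r.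
exists c, (block_companion c B); split=> //; last exact: is_eigenfun_companion y0.
move=> p q; rewrite /block_companion; case: ifP => _; last by rewrite normrN.
by case: (_ && _); rewrite ?mulr1 // mulr0 normr0 exprn_ge0.
Qed.

Lemma has_complexity_root N d (a : 'I_d -> F) x : (0 < d)%N ->
  (forall i, has_complexity N (a i)) -> x ^+ d + \sum_(i < d) a i * x ^+ i = 0 ->
  has_complexity (N.+2 ^ (d + d)) x.
Proof.
move=> d_gt0 a_le x0; have [T [v [cardT v0 va]]] := common_eigenfun a_le.
have [k k_spec] := choice va; have [A kA] := choice k_spec.
pose c := \prod_i k i; pose c' i := \prod_(j | j != i) k j.
have cE i : c = c' i * k i by rewrite /c (bigD1 i) //= mulrC.
have kN i : `|k i| <= 2 ^+ N by have [] := kA i.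
have le_expd : (N * d <= N.+2 ^ (d + d))%N.
  rewrite expnD leq_mul //; last by rewrite ltnW // ltn_expl.
  rewrite -(prednK d_gt0) expnS (leq_trans (leqW (leqnSn N))) //.
  by rewrite leq_pmulr ?expn_gt0.
have prodN : \prod_(i < d) (2 ^+ N) = 2 ^+ (N * d) :> int.
  by rewrite prodr_const card_ord exprM.
apply: (has_complexity_companion (v := v) (c := c) d_gt0
  (B := fun i s t => c' i * A i s t) (b := fun i => c%:~R * a i)) => //.
- have dE : (d <= N.+2 ^ d)%N by rewrite ltnW // ltn_expl.
  by rewrite expnD leq_mul // (leq_trans cardT) // leq_exp2r // leqW.
- apply: le_trans (ler_exp2n le_expd); rewrite -prodN /c normr_prod.
  by apply: ler_prod => i _; rewrite normr_ge0 kN.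
- by rewrite rmorph_prod; apply/prodf_neq0 => i _; have [] := kA i.
- move=> i s t; apply: le_trans (ler_exp2n le_expd).
  rewrite -prodN (bigD1 i) //= mulrC normrM ler_pM //.
    by have [] := kA i.
  by rewrite normr_prod; apply: ler_prod => j _; rewrite normr_ge0 kN.
- by move=> i; rewrite (cE i) rmorphM -mulrA; apply: is_eigenfunZ; have [] := kA i.
have -> : \sum_(i < d) c%:~R * a i * x ^+ i = c%:~R * \sum_(i < d) a i * x ^+ i.
  by rewrite mulr_sumr; apply: eq_bigr => i _; rewrite mulrA.
by rewrite -mulrDr x0 mulr0.
Qed.

Lemma has_complexity_int_poly_root N (P : {poly int}) x :
  (size P <= N.+1)%N -> (forall i, `|P`_i| <= 2 ^+ N) ->
  map_poly intr P != 0 :> {poly F} -> root (map_poly intr P) x ->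
  has_complexity N x.
Proof.
set Q := map_poly intr P => szP PN Q0 Qx; have Q_gt1 := root_size_gt1 Q0 Qx.
have QE : Q`_(size Q).-1 = (P`_(size Q).-1)%:~R by rewrite coef_map.
have szQ : size Q = (size Q).-1.+1 by rewrite prednK // ltnW.
apply: (has_complexity_companion (d := (size Q).-1) (T := unit) (v := fun=> 1)
  (c := P`_(size Q).-1) (B := fun i _ _ => P`_i) (b := fun i => (P`_i)%:~R)) => //.
- by rewrite -ltnS -szQ.
- by rewrite card_unit muln1 -ltnS -szQ (leq_trans _ szP) ?size_poly.
- by exists tt; rewrite oner_eq0.
- by rewrite -QE -lead_coefE lead_coef_eq0.
- by move=> i t; rewrite big_const card_unit /= addr0 mulrC.
move/rootP: Qx; rewrite horner_coef [in X in X -> _]szQ big_ord_recr /= QE => Qx0.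
by rewrite addrC -[RHS]Qx0; congr (_ + _); apply: eq_bigr => i _; rewrite coef_map.
Qed.

End Complexity.

(** * Integer polynomials annihilating an element of given complexity *)

Section CoefficientBound.
Variable R : numDomainType.
Implicit Types p q P Q : {poly R}.

Definition coef_le p P : Prop := forall i, `|p`_i| <= P`_i.

Lemma coef_leD p q P Q : coef_le p P -> coef_le q Q -> coef_le (p + q) (P + Q).
Proof.
by move=> pP qQ i; rewrite !coefD; apply: le_trans (ler_normD _ _) _; rewrite lerD.
Qed.

Lemma coef_leM p q P Q : coef_le p P -> coef_le q Q -> coef_le (p * q) (P * Q).
Proof.
move=> pP qQ i; rewrite !coefM; apply: le_trans (ler_norm_sum _ _ _) _.
by apply: ler_sum => j _; rewrite normrM ler_pM.
Qed.

Lemma coef_le_horner1 p P i : coef_le p P -> `|p`_i| <= P.[1].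
Proof.
move=> pP; have P_ge0 j : 0 <= P`_j := le_trans (normr_ge0 _) (pP j).
apply: le_trans (pP i) _; rewrite horner_coef.
under eq_bigr do rewrite expr1n mulr1.
have [iP|iP] := ltnP i (size P); last by rewrite nth_default // sumr_ge0.
by rewrite (bigD1 (Ordinal iP)) //= lerDl sumr_ge0.
Qed.

Lemma coef_le_char_poly n (M : 'M[R]_n) (m : R) : 0 <= m ->
  (forall i j, `|M i j| <= m) ->
  coef_le (char_poly M) (('X + m%:P) ^+ n *+ n`!).
Proof.
move=> m0 Mm; rewrite /char_poly /determinant.
have -> : ('X + m%:P) ^+ n *+ n`! =
    \sum_(s : 'S_n) 1 * \prod_(i < n) ('X + m%:P) :> {poly R}.
  by rewrite sumr_const card_Sn mul1r prodr_const card_ord.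
have coef_le1 : coef_le 1 1 by move=> i; rewrite coef1 normr_nat.
elim/big_ind2: _ => [i|p P q Q pP qQ|s _]; first by rewrite coef0 normr0.
  exact: coef_leD.
apply: coef_leM.
  by case: (odd_perm s) => // i; rewrite expr1 coefN normrN.
elim/big_ind2: _ => [//|p P q Q pP qQ|j _ i]; first exact: coef_leM.
rewrite !mxE !coefD coefN coefMn coefX !coefC.
apply: le_trans (ler_normD _ _) _; rewrite normrN lerD //.
  by rewrite -mulrnA normr_nat ler_nat; case: (j == s j); rewrite ?muln1 ?muln0.
by case: (i == 0)%N; rewrite ?normr0.
Qed.

End CoefficientBound.

Lemma leq_fact_exp2 n : (n`! <= 2 ^ (n * n))%N.
Proof.
elim: n => // n IHn; rewrite factS.
apply: leq_trans (leq_mul (ltnW (ltn_expl n.+1 (ltnSn 1))) IHn) _.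
by rewrite -expnD leq_exp2l //; nia.
Qed.

Lemma char_poly_coef_le N n (M : 'M[int]_n) i : (n <= N)%N ->
  (forall i j, `|M i j| <= 2 ^+ N) -> `|(char_poly M)`_i| <= 2 ^+ (2 * N ^ 2 + N).
Proof.
move=> nN MN; have exp2_ge0 k : 0 <= 2 ^+ k :> int by rewrite exprn_ge0.
apply: le_trans (coef_le_horner1 i (coef_le_char_poly (exp2_ge0 N) MN)) _.
rewrite hornerMn horner_exp hornerD hornerX hornerC.
have -> : (2 * N ^ 2 + N = N.+1 * N + N * N)%N by ring.
rewrite -[leLHS]mulr_natr exprD ler_pM ?exprn_ge0 ?addr_ge0 //.
  apply: le_trans (_ : (2 ^+ N.+1) ^+ n <= _); last first.
    by rewrite exprM ler_weXn2l // exprn_ege1.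
  rewrite lerXn2r ?nnegrE ?addr_ge0 // exprS mulrDl mul1r lerD2r.
  exact: exprn_ege1.
by rewrite -natrX ler_nat (leq_trans (leq_fact_exp2 n)) // leq_exp2l // leq_mul.
Qed.

Section AnnihilatingPolynomial.
Variable F : fieldType.

Lemma has_complexity_int_poly N (x : F) : has_complexity N x ->
  exists P : {poly int},
    [/\ (size P <= N.+1)%N, forall i, `|P`_i| <= 2 ^+ (3 * N ^ 2 + N),
        map_poly intr P != 0 :> {poly F} & root (map_poly intr P) x].
Proof.
move=> /has_complexityP[n [k [M [nN kN k0 MN]]]].
rewrite eigenvalue_root_char -map_char_poly.
set chi := char_poly M => chi_root.
have szchi : size chi = n.+1 by apply: size_char_poly.
pose P : {poly int} := \poly_(i < n.+1) (chi`_i * k ^+ i).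
exists P; split.
- exact: leq_trans (size_poly _ _) _.
- move=> i; rewrite coef_poly; case: ltnP => [lt_in|_]; last first.
    by rewrite normr0 exprn_ge0.
  have -> : (3 * N ^ 2 + N = (2 * N ^ 2 + N) + N * N)%N by ring.
  apply: ler_normM_exp2; first exact: char_poly_coef_le.
  rewrite normrX exprM; apply: le_trans (_ : (2 ^+ N) ^+ i <= _).
    by rewrite lerXn2r ?nnegrE ?exprn_ge0.
  by rewrite ler_weXn2l ?exprn_ege1 // -ltnS (leq_trans lt_in).
- apply/eqP => /polyP/(_ n); rewrite coef0 coef_map coef_poly ltnSn /=.
  have -> : chi`_n = 1.
    by have := monicP (char_poly_monic M); rewrite lead_coefE -/chi szchi.
  by rewrite mul1r rmorphXn /= => /eqP; rewrite expf_eq0 (negPf k0) andbF.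
rewrite /root; move/rootP: chi_root => <-.
rewrite (@horner_coef_wide _ n.+1) ?(leq_trans (size_poly _ _)) ?size_poly //.
rewrite (@horner_coef_wide _ n.+1) ?(leq_trans (size_poly _ _)) ?szchi //.
apply/eqP/eq_bigr => i _.
by rewrite !coef_map coef_poly ltn_ord /= rmorphM rmorphXn /= exprMn mulrA.
Qed.

Lemma root_rev_poly (Q : {poly F}) n (x : F) : (size Q <= n.+1)%N -> x != 0 ->
  root Q x -> root (\poly_(i < n.+1) Q`_(n - i)) x^-1.
Proof.
move=> szQ x0 /rootP Qx; apply/rootP; rewrite horner_poly.
transitivity (x ^- n * Q.[x]); last by rewrite Qx mulr0.
rewrite (horner_coef_wide _ szQ) mulr_sumr (reindex_inj rev_ord_inj) /=.
apply: eq_bigr => i _; have le_in : (i <= n)%N by rewrite -ltnS.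
have -> : x ^- n = x ^- (n - i) * x ^- i by rewrite -invfM -exprD subnK.
rewrite subSS subKn // exprVn.
by field; rewrite !expf_neq0.
Qed.

Lemma has_complexityV N (x : F) :
  has_complexity N x -> x != 0 -> has_complexity (N.+2 ^ 3) x^-1.
Proof.
move=> /has_complexity_int_poly[P [szP PN P0 Px]] x0.
pose Q : {poly int} := \poly_(i < N.+1) P`_(N - i).
have QE : map_poly intr Q = \poly_(i < N.+1) (map_poly intr P : {poly F})`_(N - i).
  apply/polyP => i; rewrite coef_map [RHS]coef_poly coef_poly.
  by case: ltnP => _; rewrite ?coef_map //= mulr0z.
apply: (@has_complexity_int_poly_root _ _ Q).
- apply: leq_trans (size_poly _ _) _.
  by rewrite !expnS expn0; nia.
- move=> i; rewrite coef_poly; case: ltnP => _; last by rewrite normr0 exprn_ge0.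
  apply: le_trans (PN _) (ler_exp2n _).
  by rewrite !expnS expn0; nia.
- apply: contra P0; rewrite QE => /eqP/polyP Q0; apply/eqP/polyP => i.
  have [le_iN|lt_Ni] := leqP i N; last first.
    by rewrite nth_default ?coef0 // (leq_trans (size_poly _ _)) // (leq_trans szP).
  by have := Q0 (N - i)%N; rewrite !coef0 coef_poly ltnS leq_subr subKn.
by rewrite QE root_rev_poly // (leq_trans (size_poly _ _)).
Qed.

End AnnihilatingPolynomial.

(** * Transfer to the ultrapower *)

Section UltrafilterQuantifiers.
Variables (I : Type) (F : set_system I) (FU : UltraFilter F).

Lemma ae_or (A B : set I) : F [set i | A i \/ B i] -> F A \/ F B.
Proof.
have [FA|FnA] := in_ultra_setVsetC A FU; first by left.
by move=> FAB; right; apply: filterS2 FAB FnA => i [].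
Qed.

Lemma ae_imply (A B : set I) : (F A -> F B) <-> F [set i | A i -> B i].
Proof.
split=> [AB|FAB FA]; last by apply: filterS2 FAB FA => i; apply.
have [/AB|FnA] := in_ultra_setVsetC A FU; first by apply: filterS => i Bi _.
by apply: filterS FnA => i nAi /nAi.
Qed.

Lemma ae_exists (T : I -> Type) (t0 : forall i, T i) (Q : forall i, set (T i)) :
  (exists t, F [set i | Q i (t i)]) <-> F [set i | exists t, Q i t].
Proof.
split=> [[t]|exQ]; first by apply: filterS => i Qi; exists (t i).
have ex i : exists t, (exists t', Q i t') -> Q i t.
  by have [[t Qt]|nQ] := pselect (exists t, Q i t); [exists t|exists (t0 i) => /nQ].
exists (fun i => projT1 (cid (ex i))); apply: filterS exQ => i.
exact: projT2 (cid (ex i)).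
Qed.

Lemma ae_forall (T : I -> Type) (t0 : forall i, T i) (Q : forall i, set (T i)) :
  (forall t, F [set i | Q i (t i)]) <-> F [set i | forall t, Q i t].
Proof.
split=> [FQ|FQ t]; last by apply: filterS FQ => i; apply.
have ex i : exists t, Q i t -> forall t', Q i t'.
  have [Qi|/existsNP[t nQt]] := pselect (forall t, Q i t); first by exists (t0 i).
  by exists t => /nQt.
apply: filterS (FQ (fun i => projT1 (cid (ex i)))) => i.
exact: projT2 (cid (ex i)).
Qed.

Lemma ae_exists_fin (T : finType) (Q : I -> set T) :
  F [set i | exists t, Q i t] -> exists t, F [set i | Q i t].
Proof.
move=> exQ; apply: contrapT => nQ.
have FnQ : F [set i | forall t, ~ Q i t].
  apply: filter_forall => t.
  by have [Qt|//] := in_ultra_setVsetC [set i | Q i t] FU; case: nQ; exists t.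
by apply: (@filter_not_empty _ F); apply: filterS2 exQ FnQ => i [t Qt] /(_ t).
Qed.

End UltrafilterQuantifiers.

Definition least (S : set nat) : nat :=
  xget 0%N [set n | S n /\ forall m, S m -> (n <= m)%N].

Lemma leastP (S : set nat) : (exists n, S n) ->
  S (least S) /\ forall m, S m -> (least S <= m)%N.
Proof.
move=> [n Sn]; have exS : exists n, `[< S n >] by exists n; apply/asboolP.
apply: (@xgetPex _ 0%N [set n | S n /\ forall m, S m -> (n <= m)%N]).
case: (ex_minnP exS) => m /asboolP Sm minm; exists m; split=> // k Sk.
by apply: minm; apply/asboolP.
Qed.

Section Hypernaturals.
Variables (I : Type) (F : set_system I) (FU : UltraFilter F).
Local Notation hnat := (hnat FU).
Local Notation cls u := (ucls FU u).
Implicit Types (u v : I -> nat).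

Lemma ucls_ind (A : Type) (P : upow FU A -> Prop) :
  (forall u : I -> A, P (ucls FU u)) -> forall x, P x.
Proof. by move=> Pcls x; rewrite -(urepK x). Qed.

Lemma hle_ucls u v : hle (cls u) (cls v) <-> F [set i | (u i <= v i)%N].
Proof. by rewrite /hle /star !uappE uholdsE; split=> /asboolP. Qed.

Lemma hlt_ucls u v : hlt (cls u) (cls v) <-> F [set i | (u i < v i)%N].
Proof. by rewrite /hlt /star !uappE uholdsE; split=> /asboolP. Qed.

Lemma hadd_ucls u v : hadd (cls u) (cls v) = cls (fun i => u i + v i)%N.
Proof. by rewrite /hadd /star !uappE. Qed.

Lemma hmul_ucls u v : hmul (cls u) (cls v) = cls (fun i => u i * v i)%N.
Proof. by rewrite /hmul /star !uappE. Qed.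

Lemma hexp_ucls_star u n : hexp (cls u) (star FU n) = cls (fun i => u i ^ n)%N.
Proof. by rewrite /hexp /star !uappE. Qed.

Lemma hle_anti (x y : hnat) : hle x y -> hle y x -> x = y.
Proof.
elim/ucls_ind: x => u; elim/ucls_ind: y => v /hle_ucls uv /hle_ucls vu.
apply/ucls_eq.
by apply: filterS2 uv vu => i /= uv vu; apply/eqP; rewrite eqn_leq uv.
Qed.

Lemma hleast_ucls (S : set hnat) (Q : I -> set nat) :
  (forall u, S (cls u) <-> F [set i | Q i (u i)]) -> F [set i | exists n, Q i n] ->
  hleast S = cls (fun i => least (Q i)).
Proof.
move=> SQ exQ; set l := cls _; have Sl : S l.
  by apply/SQ; apply: filterS exQ => i /= /leastP[].
have minl y : S y -> hle l y.
  elim/ucls_ind: y => u /SQ Qu; apply/hle_ucls; apply: filterS Qu => i Qi.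
  by have [_] := leastP (ex_intro _ (u i) Qi); apply.
have [Sh minh] : [set x | S x /\ forall y, S y -> hle x y] (hleast S).
  by apply: xgetPex; exists l.
by apply: hle_anti; [apply: minh|apply: minl].
Qed.

Lemma hgreatestP (S : set hnat) (Q : I -> set nat) :
  (forall u, S (cls u) <-> F [set i | Q i (u i)]) ->
  F [set i | exists m, Q i m /\ forall n, Q i n -> (n <= m)%N] ->
  S (hgreatest S) /\ forall x, S x -> hle x (hgreatest S).
Proof.
move=> SQ /(ae_exists _ (fun=> 0%N))[m mP].
apply: (@xgetPex _ _ [set x | S x /\ forall y, S y -> hle y x]).
exists (cls m); split; first by apply/SQ; apply: filterS mP => i [].
elim/ucls_ind=> u /SQ Qu; apply/hle_ucls.
by apply: filterS2 mP Qu => i [_ maxm] /maxm.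
Qed.

Lemma hlt_hceil_root (x n : hnat) i : (0 < i)%N ->
  hlt x (hceil_root n i) <-> hlt (hexp x (star FU i)) n.
Proof.
move=> i0; elim/ucls_ind: x => u; elim/ucls_ind: n => n.
have ex j : exists r, (n j <= r ^ i)%N.
  exists (n j); rewrite -{1}(expn1 (n j)).
  by case: (n j) => // k; rewrite leq_pexp2l.
have -> : hceil_root (cls n) i = cls (fun j => least [set r | n j <= r ^ i]%N).
  apply: hleast_ucls => [v|]; first by rewrite /= hexp_ucls_star; apply: hle_ucls.
  by apply: filterS filterT => j _; apply: ex.
rewrite hexp_ucls_star !hlt_ucls; split; apply: filterS => j /=;
  have [nr minr] := leastP (ex j); rewrite !ltnNge; apply: contra.
  exact: minr.
by move=> ru; apply: leq_trans nr _; rewrite leq_exp2r.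
Qed.

End Hypernaturals.

(** * The complexity function of a prime field *)

Section PrimeFieldComplexity.
Local Open Scope nat_scope.

Definition fQbar_witness (q x v n m k : nat) (M : nat -> nat -> nat) : Prop :=
  [/\ 1 <= n /\ k %% q <> 0,
      forall a b, a < n -> b < n -> M a b < q,
      forall a b, a < n -> b < n -> minn (M a b) (q - M a b) <= m,
      eigenvalue_mod q n M ((k * x) %% q)
    & v = n + up_log 2 (maxn m k)].

Definition fQbar_value (q x : nat) : set nat :=
  [set v | exists n m k M, fQbar_witness q x v n m k M].

Definition fQbar_mod (q x : nat) : nat := least (fQbar_value q x).

Lemma fQbar_value_ex q x : prime q -> exists v, fQbar_value q x v.
Proof.
move=> pr_q; have q_gt0 := prime_gt0 pr_q; have q_gt1 := prime_gt1 pr_q.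
exists (1 + up_log 2 (maxn q 1)), 1, q, 1, (fun _ _ => x %% q); split=> //.
- by rewrite modn_small.
- by move=> a b _ _; rewrite ltn_mod.
- by move=> a b _ _; rewrite geq_min ltnW // ltn_mod.
apply/eigenvalueP; exists (const_mx 1%R); last first.
  by apply/eqP => /rowP/(_ ord0); rewrite !mxE => /eqP; rewrite oner_eq0.
by apply/rowP => j; rewrite !mxE big_ord1 !mxE mul1r mulr1 mul1n.
Qed.

End PrimeFieldComplexity.

Section PrimeFieldBounds.
Variable q : nat.
Hypothesis pr_q : prime q.

Lemma natr_Fp_eq a b : a%:R = b%:R :> 'F_q <-> a = b %[mod q].
Proof.
split=> ab; last by rewrite -[LHS](Fp_nat_mod pr_q) ab Fp_nat_mod.
by rewrite -!(val_Fp_nat pr_q) ab.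
Qed.

Lemma natr_Fp_eq0 k : (k%:R == 0 :> 'F_q) = (k %% q == 0)%N.
Proof. by rewrite -(dvdn_pcharf (pchar_Fp pr_q)). Qed.

Definition balanced_residue (a : nat) : int :=
  if (a <= q - a)%N then a%:Z else a%:Z - q%:Z.

Lemma intr_balanced_residue (a : nat) : (balanced_residue a)%:~R = a%:R :> 'F_q.
Proof.
rewrite /balanced_residue; case: ifP => // _.
by rewrite rmorphB /= -[(q%:Z)%:~R]pmulrn pchar_Fp_0 ?subr0.
Qed.

Lemma norm_balanced_residue (a : nat) :
  (a < q)%N -> `|balanced_residue a| = (minn a (q - a))%:Z.
Proof. by rewrite /balanced_residue; case: ifP; lia. Qed.

Lemma natr_absz_modz_Fp (z : int) : (absz (z %% q)%Z)%:R = z%:~R :> 'F_q.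
Proof.
rewrite -[LHS]/((Posz _)%:~R).
have -> : Posz (absz (z %% q)%Z) = (z %% q)%Z by have := prime_gt0 pr_q; lia.
rewrite [in RHS](divz_eq z q) [RHS]intrD [X in X + _]intrM.
by rewrite -[(q%:Z)%:~R]pmulrn pchar_Fp_0 ?mulr0 ?add0r.
Qed.

Lemma minn_absz_modz_le (z : int) :
  (minn (absz (z %% q)%Z) (q - absz (z %% q)%Z) <= absz z)%N.
Proof.
have q_gt0 := prime_gt0 pr_q; rewrite geq_min.
have [z_ge0|z_lt0] := leP 0 z.
  apply/orP; left; have -> : z = (absz z)%:Z by lia.
  by rewrite modz_nat absz_nat leq_mod.
have [->//|r0] := eqVneq (absz (z %% q)%Z) 0%N; apply/orP; right.
have := divz_eq z q; have : (z %% q)%Z < q by lia.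
have : 0 < (z %% q)%Z by lia.
move: (z %/ q)%Z (z %% q)%Z {r0} => d r r0 rq zE.
have d_lt0 : d < 0 by nia.
nia.
Qed.

Lemma has_complexity_fQbar_mod x N :
  (fQbar_mod q x <= N)%N -> has_complexity N (x%:R : 'F_q).
Proof.
rewrite /fQbar_mod.
have [[n [m [k [M [[n1 k0] Mq Mm eigM ->]]]]] _] :=
  leastP (fQbar_value_ex x pr_q) => leN.
have mkN : (maxn m k <= 2 ^ N)%N.
  apply: leq_trans (up_logP _ (ltnSn 1)) _; rewrite leq_exp2l //.
  by apply: leq_trans leN; rewrite leq_addl.
apply/has_complexityP; exists n, k%:Z.
exists (\matrix_(i, j) balanced_residue (M i j)); split.
- by apply: leq_trans leN; rewrite leq_addr.
- by rewrite -natrX natz lez_nat (leq_trans _ mkN) // leq_maxr.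
- by rewrite [_%:~R]/(k%:R) natr_Fp_eq0; apply/eqP.
- move=> i j; rewrite mxE norm_balanced_residue ?Mq // -natrX natz lez_nat.
  by rewrite (leq_trans _ mkN) // (leq_trans (Mm _ _ _ _)) // leq_maxl.
rewrite [_%:~R]/(k%:R) -natrM -(Fp_nat_mod pr_q); move: eigM.
rewrite /eigenvalue_mod.
suff -> : map_mx intr (\matrix_(i, j) balanced_residue (M i j)) =
            \matrix_(i < n, j < n) (M i j)%:R :> 'M['F_q]_n by [].
by apply/matrixP => i j; rewrite !mxE intr_balanced_residue.
Qed.

Lemma fQbar_mod_has_complexity x N :
  has_complexity N (x%:R : 'F_q) -> (fQbar_mod q x <= N + N)%N.
Proof.
move=> /has_complexityP[n [k [M [nN kN k0 MN eigM]]]].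
have [_ minf] := leastP (fQbar_value_ex x pr_q).
have n_gt0 : (0 < n)%N.
  case: n M eigM {nN MN} => // M /eigenvalueP[v _ /negP[]].
  by apply/eqP/rowP => -[].
have absN (z : int) : `|z| <= 2 ^+ N -> (absz z <= 2 ^ N)%N.
  by rewrite -natrX natz -abszE lez_nat.
pose R a b : nat := if (insub a, insub b) is (Some i, Some j)
  then absz ((Num.sg k * M i j) %% q)%Z else 0%N.
have RE (i j : 'I_n) : R i j = absz ((Num.sg k * M i j) %% q)%Z by rewrite /R !valK.
apply: leq_trans (minf (n + up_log 2 (maxn (2 ^ N) (absz k)))%N _) _; last first.
  by rewrite leq_add // up_log_min // geq_max leqnn absN.
have absk : (absz k)%:R = (Num.sg k * k)%:~R :> 'F_q.
  by rewrite -[LHS]/((Posz _)%:~R) abszE normrEsg.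
have k_neq0 : k != 0 by apply: contraNneq k0 => ->.
exists n, (2 ^ N)%N, (absz k), R; split; last exact: erefl.
- split=> //; apply/eqP; rewrite -natr_Fp_eq0 absk rmorphM mulf_neq0 //=.
  by case: sgrP k_neq0 => //= _ _; rewrite ?oner_eq0 // rmorphN1 oppr_eq0 oner_eq0.
- move=> a b an bn; rewrite (RE (Ordinal an) (Ordinal bn)).
  by have := prime_gt0 pr_q; lia.
- move=> a b an bn; rewrite (RE (Ordinal an) (Ordinal bn)).
  apply: leq_trans (minn_absz_modz_le _) _; rewrite abszM absz_sg k_neq0 mul1n.
  exact: absN.
rewrite /eigenvalue_mod (Fp_nat_mod pr_q) natrM absk.
have -> : \matrix_(i < n, j < n) (R i j)%:R =
          (Num.sg k)%:~R *: map_mx intr M :> 'M['F_q]_n.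
  by apply/matrixP => i j; rewrite !mxE RE natr_absz_modz_Fp rmorphM.
have /eigenvalueP[v vM v0] := eigM; apply/eigenvalueP; exists v => //.
by rewrite -scalemxAr vM scalerA rmorphM mulrA.
Qed.

End PrimeFieldBounds.

Section PrimeFieldTransfer.
Variables (I : Type) (F : set_system I) (FU : UltraFilter F).
Variables (p : hnat FU) (p_prime : hprime p).
Local Notation K := (Fp p_prime).
Local Notation P i := (urep p i).
Local Notation cls u := (ucls FU u).
Local Notation inK u := (inFp p_prime (cls u)).

(** * The internal complexity function *)

Lemma inFp_neq0 (u : I -> nat) : inK u != 0 <-> F [set i | u i %% P i <> 0]%N.
Proof.
have inK0 : F [set i | u i %% P i = 0]%N <-> inK u = 0.
  apply: iff_trans (inFp_eq p_prime u (fun=> 0%N)).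
  by split; apply: filterS => i /=; rewrite mod0n.
split=> [/eqP u0|nz]; last first.
  apply/eqP => /inK0 u0; apply: (@filter_not_empty _ F).
  by apply: filterS2 nz u0 => i.
by have [/inK0|] := in_ultra_setVsetC [set i | u i %% P i = 0]%N FU.
Qed.

Lemma forall_hlt2_ucls (n : I -> nat) (S : hnat FU -> hnat FU -> Prop)
    (Q : I -> nat -> nat -> Prop) :
  (forall a b, S (cls a) (cls b) <-> F [set i | Q i (a i) (b i)]) ->
  (forall a b, hlt a (cls n) -> hlt b (cls n) -> S a b) <->
  F [set i | forall a b, (a < n i)%N -> (b < n i)%N -> Q i a b].
Proof.
move=> SQ; split=> [Slt|FQ].
  apply/(ae_forall _ (fun=> 0%N)
    (fun i a => forall b, a < n i -> b < n i -> Q i a b)%N) => a.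
  apply/(ae_forall _ (fun=> 0%N)
    (fun i b => a i < n i -> b < n i -> Q i (a i) b)%N) => b.
  apply/(ae_imply _ _ [set i | b i < n i -> Q i (a i) (b i)]%N) => /hlt_ucls an.
  by apply/(ae_imply _ _ [set i | Q i (a i) (b i)]) => /hlt_ucls bn; apply/SQ/Slt.
elim/ucls_ind=> a; elim/ucls_ind=> b /hlt_ucls an /hlt_ucls bn; apply/SQ.
by apply: filterS3 FQ an bn => i; apply.
Qed.

Lemma internal_mx_ucls (n : I -> nat) (M : I -> nat -> nat -> nat) :
  internal_mx p (cls n) (ucls FU M) <->
  F [set i | forall a b, a < n i -> b < n i -> M i a b < P i]%N.
Proof.
apply: forall_hlt2_ucls => a b; rewrite /hentry !uappE.
exact: (hltE p (fun i => M i (a i) (b i))).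
Qed.

Lemma habs_hentry_le_ucls (n m : I -> nat) (M : I -> nat -> nat -> nat) :
  (forall a b, hlt a (cls n) -> hlt b (cls n) ->
     hle (habs p (hentry (ucls FU M) a b)) (cls m)) <->
  F [set i | forall a b, a < n i -> b < n i ->
     minn (M i a b) (P i - M i a b) <= m i]%N.
Proof.
apply: forall_hlt2_ucls => a b; rewrite /hentry !uappE -[p in habs p]urepK.
by rewrite /habs /hmin /hsub /star !uappE; apply: hle_ucls.
Qed.

Lemma heigenvalue_ucls (n k u : I -> nat) (M : I -> nat -> nat -> nat) :
  heigenvalue (cls n) (ucls FU M) (inK k * inK u) <->
  F [set i | eigenvalue_mod (P i) (n i) (M i) ((k i * u i) %% P i)]%N.
Proof.
rewrite -[(_ * _)]/(Fmul _ _) FmulE /heigenvalue /= hmodE.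
rewrite -[X in uapp (uapp (uapp (uapp _ X) _) _) _]urepK /star !uappE uholdsE.
by split=> /asboolP.
Qed.

Lemma fQbar_witness_ucls (u v n m k : I -> nat) (M : I -> nat -> nat -> nat) :
  [/\ hle (star FU 1%N) (cls n) /\ inK k != 0,
      internal_mx p (cls n) (ucls FU M),
      forall a b, hlt a (cls n) -> hlt b (cls n) ->
        hle (habs p (hentry (ucls FU M) a b)) (cls m),
      heigenvalue (cls n) (ucls FU M) (inK k * inK u)
    & cls v = hadd (cls n) (hceil_log2 (hmax (cls m) (cls k)))] <->
  F [set i | fQbar_witness (P i) (u i) (v i) (n i) (m i) (k i) (M i)].
Proof.
have valueE : cls v = hadd (cls n) (hceil_log2 (hmax (cls m) (cls k))) <->
    F [set i | v i = n i + up_log 2 (maxn (m i) (k i))]%N.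
  by rewrite /hadd /hceil_log2 /hmax /star !uappE; apply: ucls_eq.
split=> [[[/hle_ucls n1 /inFp_neq0 k0] /internal_mx_ucls Mp]|W].
  move=> /habs_hentry_le_ucls Mm /heigenvalue_ucls eigM /valueE vE.
  apply: filterS3 (filterI n1 k0) (filterI Mp Mm) (filterI eigM vE).
  by move=> i /= [? ?] [? ?] [? ?].
split; first split.
- by apply/hle_ucls; apply: filterS W => i /= [[]].
- by apply/inFp_neq0; apply: filterS W => i /= [[]].
- by apply/internal_mx_ucls; apply: filterS W => i /= [].
- by apply/habs_hentry_le_ucls; apply: filterS W => i /= [].
- by apply/heigenvalue_ucls; apply: filterS W => i /= [].
- by apply/valueE; apply: filterS W => i /= [].
Qed.

Lemma fQbar_ucls (u : I -> nat) :
  fQbar (inK u) = cls (fun i => fQbar_mod (P i) (u i)).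
Proof.
apply: hleast_ucls => [v|]; last first.
  by apply: filterS (prime_ae p_prime) => i /= /fQbar_value_ex; apply.
split=> [[n [m [k [M]]]]|].
  elim/ucls_ind: n => n; elim/ucls_ind: m => m; elim/ucls_ind: k => k.
  elim/ucls_ind: M => M /fQbar_witness_ucls; apply: filterS => i W.
  by exists (n i), (m i), (k i), (M i).
move=> /(ae_exists _ (fun=> 0%N))[n /(ae_exists _ (fun=> 0%N))[m]].
move=> /(ae_exists _ (fun=> 0%N))[k /(ae_exists _ (fun=> fun _ _ => 0%N))[M W]].
by exists (cls n), (cls m), (cls k), (ucls FU M); apply/fQbar_witness_ucls.
Qed.

(** * Residues *)

Definition residue (x : K) (i : I) : 'F_(P i) := (urep (Fp_val x) i)%:R.

Definition lifts (f : forall i, 'F_(P i)) (x : K) : Prop :=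
  F [set i | residue x i = f i].

Lemma inFp_urep (x : K) : inK (urep (Fp_val x)) = x.
Proof.
have [u -> up] := FpP x; apply/inFp_eq; rewrite /= hmodE.
apply: filterS (urep_cls FU (fun i => u i %% P i)%N) => i /= ->; exact: modn_mod.
Qed.

Lemma lifts_inFp (u : I -> nat) : lifts (fun i => (u i)%:R) (inK u).
Proof.
rewrite /lifts /residue /= hmodE.
apply: filterS2 (prime_ae p_prime) (urep_cls FU (fun i => u i %% P i)%N).
by move=> i /= pr_i ->; rewrite (Fp_nat_mod pr_i).
Qed.

Lemma lifts_residue (x : K) : lifts (residue x) x.
Proof. exact: filterS filterT. Qed.

Lemma lifts_exists (f : forall i, 'F_(P i)) : exists x, lifts f x.
Proof.
exists (inK (fun i => val (f i))).
by apply: filterS (lifts_inFp (fun i => val (f i))) => i /= ->; apply: natr_Zp.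
Qed.

Lemma lifts_eq f g x y : lifts f x -> lifts g y -> x = y <-> F [set i | f i = g i].
Proof.
move=> fx gy; split=> [xy|fg].
  by apply: filterS2 fx gy => i /= <- <-; rewrite xy.
rewrite -[x]inFp_urep -[y]inFp_urep; apply/inFp_eq.
apply: filterS2 (prime_ae p_prime) (filterI fg (filterI fx gy)).
move=> i /= pr_i [fgi [fi gi]]; apply/(natr_Fp_eq pr_i).
by rewrite -[LHS]/(residue x i) -[RHS]/(residue y i) fi gi.
Qed.

Lemma liftsD f g x y : lifts f x -> lifts g y -> lifts (fun i => f i + g i) (x + y).
Proof.
move=> fx gy; rewrite -[x]inFp_urep -[y]inFp_urep -[_ + _]/(Fadd _ _) FaddE.
have := lifts_inFp (fun i => urep (Fp_val x) i + urep (Fp_val y) i)%N.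
by move=> xy; apply: filterS3 xy fx gy => i /= -> <- <-; rewrite natrD.
Qed.

Lemma liftsM f g x y : lifts f x -> lifts g y -> lifts (fun i => f i * g i) (x * y).
Proof.
move=> fx gy; rewrite -[x]inFp_urep -[y]inFp_urep -[_ * _]/(Fmul _ _) FmulE.
have := lifts_inFp (fun i => urep (Fp_val x) i * urep (Fp_val y) i)%N.
by move=> xy; apply: filterS3 xy fx gy => i /= -> <- <-; rewrite natrM.
Qed.

Lemma lifts_nat n : lifts (fun=> n%:R) n%:R.
Proof.
elim: n => [|n IHn]; first exact: (lifts_inFp (fun=> 0%N)).
rewrite -natr1; apply: filterS (liftsD IHn (lifts_inFp (fun=> 1%N))).
by move=> i /= ->; rewrite natr1.
Qed.

Lemma liftsN f x : lifts f x -> lifts (fun i => - f i) (- x).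
Proof.
move=> fx; have [y gy] := lifts_exists (fun i => - f i).
suff -> : - x = y by [].
apply/eqP; rewrite eq_sym -addr_eq0; apply/eqP.
apply/(lifts_eq (liftsD gy fx) (lifts_nat 0)).
by apply: filterS filterT => i _ /=; rewrite addNr.
Qed.

Lemma lifts_int (z : int) : lifts (fun=> z%:~R) z%:~R.
Proof.
case: z => n; first exact: lifts_nat.
rewrite NegzE mulrNz -pmulrn.
by apply: filterS (liftsN (lifts_nat n.+1)) => i /= ->; rewrite mulrNz -pmulrn.
Qed.

Lemma liftsX f x n : lifts f x -> lifts (fun i => f i ^+ n) (x ^+ n).
Proof.
move=> fx; elim: n => [|n IHn]; first exact: lifts_nat 1%N.
by rewrite exprS; apply: filterS (liftsM fx IHn) => i /= ->; rewrite exprS.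
Qed.

Lemma lifts_sum (J : Type) (r : seq J) f (a : J -> K) :
  (forall j, lifts (f j) (a j)) ->
  lifts (fun i => \sum_(j <- r) f j i) (\sum_(j <- r) a j).
Proof.
move=> fa; elim: r => [|j r IHr].
  by rewrite big_nil; apply: filterS (lifts_nat 0) => i /= ->; rewrite big_nil.
rewrite big_cons; apply: filterS (liftsD (fa j) IHr) => i /= ->.
by rewrite big_cons.
Qed.

Lemma lifts_neq0 f x : lifts f x -> x != 0 -> F [set i | f i != 0].
Proof.
move=> fx /eqP x0; have [f0|] := in_ultra_setVsetC [set i | f i = 0] FU.
  by case: x0; apply/(lifts_eq fx (lifts_nat 0)).
by apply: filterS => i /= /eqP.
Qed.

Lemma liftsV f x : lifts f x -> lifts (fun i => (f i)^-1) x^-1.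
Proof.
move=> fx; have [y gy] := lifts_exists (fun i => (f i)^-1).
suff -> : x^-1 = y by [].
have [x0|x0] := eqVneq x 0.
  rewrite x0 invr0; apply/(lifts_eq (lifts_nat 0) gy).
  move/(lifts_eq fx (lifts_nat 0)): x0; apply: filterS => i /= ->.
  by rewrite invr0.
apply: (mulfI x0); rewrite divff //; apply/(lifts_eq (lifts_nat 1) (liftsM fx gy)).
by apply: filterS (lifts_neq0 fx x0) => i /= fi; rewrite divff.
Qed.

Lemma lifts_horner_int (Q : {poly int}) f x : lifts f x ->
  lifts (fun i => (map_poly intr Q).[f i]) (map_poly intr Q).[x].
Proof.
move=> fx; rewrite /map_poly horner_poly.
have lifts_term (j : 'I_(size Q)) := liftsM (lifts_int Q`_j) (liftsX j fx).
apply: filterS (lifts_sum (index_enum _) lifts_term) => i /= ->.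
by rewrite horner_poly.
Qed.

Lemma residue_exists (Q : forall i, set 'F_(P i)) :
  (exists x, F [set i | Q i (residue x i)]) <-> F [set i | exists z, Q i z].
Proof.
split=> [[x]|]; first by apply: filterS => i Qi; exists (residue x i).
move=> /(ae_exists _ (fun=> 0))[f Qf]; have [x fx] := lifts_exists f.
by exists x; apply: filterS2 fx Qf => i /= ->.
Qed.

Lemma residue_forall_tuple d (Q : forall i, set ('I_d -> 'F_(P i))) :
  (forall a : 'I_d -> K, F [set i | Q i (fun j => residue (a j) i)]) <->
  F [set i | forall b, Q i b].
Proof.
split=> [FQ|FQ a]; last by apply: filterS FQ => i; apply.
apply/(ae_forall _ (fun _ _ => 0)) => f.
have /choice[a fa] := fun j => lifts_exists (fun i => f i j).
have {}fa : F [set i | forall j, residue (a j) i = f i j] by apply: filter_forall.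
by apply: filterS2 fa (FQ a) => i /= /funext ->.
Qed.

Lemma fQbar_residue (x : K) :
  fQbar x = cls (fun i => fQbar_mod (P i) (val (residue x i))).
Proof.
rewrite -{1}[x]inFp_urep fQbar_ucls; apply/ucls_eq.
have /hltE up : hlt (cls (urep (Fp_val x))) p by rewrite urepK; case: (x).
apply: filterS2 (prime_ae p_prime) up => i /= pr_i ui.
have -> : val (residue x i) = (urep (Fp_val x) i %% P i)%N by exact: val_Fp_nat.
by rewrite modn_small.
Qed.

(** * The properties phi_d *)

Definition solves (d : nat) (L : fieldType) (a : 'I_d -> L) (z : L) : Prop :=
  if d == 2 then \sum_(j < d) a j ^+ 2 = z ^+ 2
  else z ^+ d + \sum_(j < d) a j * z ^+ j = 0.

Lemma monic_root_residue d (a : 'I_d -> K) (x : K) :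
  (x ^+ d + \sum_(j < d) a j * x ^+ j = 0) <->
  F [set i |
    residue x i ^+ d + \sum_(j < d) residue (a j) i * residue x i ^+ j = 0].
Proof.
apply: lifts_eq (lifts_nat 0); apply: liftsD; first exact/liftsX/lifts_residue.
by apply: lifts_sum => j; apply: liftsM; [|apply: liftsX]; apply: lifts_residue.
Qed.

Lemma solves_residue d (a : 'I_d -> K) (z : K) :
  solves a z <-> F [set i | solves (fun j => residue (a j) i) (residue z i)].
Proof.
rewrite /solves; case: (d == 2); last exact: monic_root_residue.
by apply: lifts_eq; [apply: lifts_sum => j|]; apply/liftsX/lifts_residue.
Qed.

Lemma solves_pair (L : fieldType) (x y z : L) :
  solves (pair_fun x y) z <-> x ^+ 2 + y ^+ 2 = z ^+ 2.
Proof. by rewrite /solves /= big_ord_recl big_ord1. Qed.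

Definition phi_mod (d q n : nat) : Prop :=
  forall a : 'I_d -> 'F_q, (forall j, fQbar_mod q (val (a j)) < n)%N ->
  exists z, solves a z.

Lemma phiP d (n : hnat FU) : phi p_prime d n <->
  forall a : 'I_d -> K, (forall j, hlt (fQbar (a j)) n) -> exists z, solves a z.
Proof.
rewrite /phi /solves; have [->|d2] := eqVneq d 2%N; last by [].
split=> [phin a an|phin x y xn yn].
  have [z zE] := phin (a 0) (a 1) (an 0) (an 1); exists z.
  by rewrite -zE big_ord_recl big_ord1; congr (_ + a _ ^+ 2); apply: val_inj.
have [z /solves_pair zE] :=
  phin (pair_fun x y) (pair_funP (P := fun a => hlt (fQbar a) n) xn yn).
by exists z.
Qed.

Lemma phi_ucls d (n : I -> nat) :
  phi p_prime d (cls n) <-> F [set i | phi_mod d (P i) (n i)].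
Proof.
have fQbar_lt (a : 'I_d -> K) : (forall j, hlt (fQbar (a j)) (cls n)) <->
    F [set i | forall j, fQbar_mod (P i) (val (residue (a j) i)) < n i]%N.
  split=> [an|an j].
    by apply: filter_forall => j; have := an j; rewrite fQbar_residue => /hlt_ucls.
  by rewrite fQbar_residue; apply/hlt_ucls; apply: filterS an => i /=.
have solvable (a : 'I_d -> K) : (exists z, solves a z) <->
    F [set i | exists z, solves (fun j => residue (a j) i) z].
  rewrite -residue_exists.
  by split=> -[z az]; exists z; apply/solves_residue.
apply: iff_trans (phiP _ _) _; split=> [phin|phin a /fQbar_lt an]; last first.
  by apply/solvable; apply: filterS2 phin an => i; apply.
apply/(residue_forall_tuple (fun i b =>
  (forall j, fQbar_mod (P i) (val (b j)) < n i)%N -> exists z, solves b z)) => a.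
by apply/ae_imply => /fQbar_lt/phin/solvable.
Qed.

Lemma Cp_lt_nhat d x : phi_index d -> Cp p_prime x -> hlt x (nhat p_prime d).
Proof.
move=> dP /(_ d 1%N dP isT) /(hlt_hceil_root _ _ (ltn0Sn 0)).
elim/ucls_ind: x => u; rewrite hexp_ucls_star -(urepK (nhat _ _)) => /hlt_ucls lt_u.
by apply/hlt_ucls; apply: filterS lt_u => i /=; rewrite expn1.
Qed.

Section NoSqrtN1.
Hypothesis no_sqrtN1 : ~ exists x : K, x ^+ 2 = -1.

Lemma sqr_neqN1_ae : F [set i | forall z : 'F_(P i), z ^+ 2 != -1].
Proof.
have [/residue_exists[x xE]|nsq] :=
    in_ultra_setVsetC [set i | exists z : 'F_(P i), z ^+ 2 = -1] FU.
  case: no_sqrtN1; exists x.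
  exact/(lifts_eq (liftsX 2 (lifts_residue x)) (lifts_int (-1))).
by apply: filterS nsq => i /= nsq z; apply/eqP => zE; apply: nsq; exists z.
Qed.

Lemma Fp_sqr_or_opp (x : K) : exists y : K, x = y ^+ 2 \/ x = - y ^+ 2.
Proof.
have : F [set i | exists y, residue x i = y ^+ 2 \/ residue x i = - y ^+ 2].
  by apply: filterS sqr_neqN1_ae => i /= /finField_sqr_or_opp.
move=> /residue_exists[y /ae_or xy]; exists y.
have sqr_y := liftsX 2 (lifts_residue y).
by case: xy => [xy|xy]; [left|right];
  [apply/(lifts_eq (lifts_residue x) sqr_y)
  |apply/(lifts_eq (lifts_residue x) (liftsN sqr_y))].
Qed.

Lemma unsolvable_ae d : phi_index d ->
  F [set i | exists a : 'I_d -> 'F_(P i), ~ exists z, solves a z].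
Proof.
move=> dP; apply: filterS2 (prime_ae p_prime) sqr_neqN1_ae => i /= pr_i noN1.
case/orP: dP => [/eqP ->|/andP[odd_d d_gt1]].
  have [x [y xyz]] := Fp_sum_sqr_not_sqr pr_i noN1.
  by exists (pair_fun x y) => -[z /solves_pair/eqP]; rewrite (negPf (xyz z)).
have d2 : (d == 2) = false by apply/eqP => dE; rewrite dE in odd_d.
have [c cP] := finField_rootfree 'F_(P i) d_gt1.
exists (fun j => if val j == 0%N then c else if val j == 1%N then -1 else 0).
rewrite /solves d2 => -[x]; move/eqP: (cP x); apply: contra_not => <-.
case: d d_gt1 {cP odd_d d2} => [|[|d]] // _.
rewrite [in RHS]big_ord_recl [in RHS]big_ord_recl /= expr0 mulr1 expr1 mulN1r.
rewrite [in RHS]big1 ?addr0; last by move=> j _; rewrite mul0r.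
by rewrite -addrA; congr (_ + _); rewrite addrC.
Qed.

Lemma nhatP d : phi_index d ->
  phi p_prime d (nhat p_prime d) /\
  forall n, phi p_prime d n -> hle n (nhat p_prime d).
Proof.
move=> dP; have d_gt0 : (0 < d)%N by move: dP; rewrite /phi_index; case: d.
apply: (hgreatestP (Q := fun i => phi_mod d (P i)) (phi_ucls d)).
apply: filterS (unsolvable_ae dP) => i [a na].
have bounded n :
    `[< phi_mod d (P i) n >] -> (n <= \max_j fQbar_mod (P i) (val (a j)))%N.
  move=> /asboolP phin; rewrite leqNgt; apply/negP => maxn; apply/na/phin => j.
  by apply: leq_ltn_trans maxn; apply: leq_bigmax.
have phi0 : exists n, `[< phi_mod d (P i) n >].
  by exists 0%N; apply/asboolP => b /(_ (Ordinal d_gt0)); rewrite ltn0.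
case: (ex_maxnP phi0 bounded) => m /asboolP phim maxm; exists m; split=> // n phin.
by apply: maxm; apply/asboolP.
Qed.

End NoSqrtN1.
End PrimeFieldTransfer.

(** * The field of elements of complexity in a cut *)

Section CutField.
Variables (I : Type) (F : set_system I) (FU : UltraFilter F).
Variables (p : hnat FU) (p_prime : hprime p).
Local Notation K := (Fp p_prime).
Local Notation P i := (urep p i).
Local Notation cls u := (ucls FU u).
Variable C : set (hnat FU).
Hypotheses (C_cut : is_cut C) (C_semiring : is_subsemiring C).
Local Notation R := (RC p_prime C).

Lemma cut_ae (u v : I -> nat) :
  F [set i | (u i <= v i)%N] -> C (cls v) -> C (cls u).
Proof. by move=> uv; apply: C_cut; apply/hle_ucls. Qed.

Lemma cut_add (u v : I -> nat) :
  C (cls u) -> C (cls v) -> C (cls (fun i => u i + v i)%N).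
Proof. by case: C_semiring => _ _ CD _ Cu Cv; rewrite -hadd_ucls; apply: CD. Qed.

Lemma cut_star n : C (star FU n).
Proof.
have [C0 C1 _ _] := C_semiring; elim: n => // n IHn.
by apply: cut_ae (cut_add IHn C1); apply: filterS filterT => i _ /=; rewrite addn1.
Qed.

Lemma cut_sum (J : Type) (r : seq J) (u : J -> I -> nat) :
  (forall j, C (cls (u j))) -> C (cls (fun i => \sum_(j <- r) u j i)%N).
Proof.
move=> Cu; elim: r => [|j r IHr].
  by apply: cut_ae (cut_star 0); apply: filterS filterT => i _ /=; rewrite big_nil.
apply: cut_ae (cut_add (Cu j) IHr); apply: filterS filterT => i _ /=.
by rewrite big_cons.
Qed.

Lemma cut_exp e (u : I -> nat) : C (cls u) -> C (cls (fun i => (u i).+2 ^ e)%N).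
Proof.
move=> Cu; have [_ C1 _ CM] := C_semiring; elim: e => [|e IHe]; first exact: C1.
have := CM _ _ (cut_add Cu (cut_star 2)) IHe; rewrite hmul_ucls; apply: cut_ae.
by apply: filterS filterT => i _ /=; rewrite expnS addn2.
Qed.

Lemma RCP (x : K) : R x <->
  exists2 N : I -> nat, C (cls N) & F [set i | has_complexity (N i) (residue x i)].
Proof.
rewrite /RC /preimage /= fQbar_residue; split=> [Cx|[N CN xN]].
  exists (fun i => fQbar_mod (P i) (val (residue x i))) => //.
  apply: filterS (prime_ae p_prime) => i /= pr_i.
  have := leqnn (fQbar_mod (P i) (val (residue x i))).
  by move=> /(has_complexity_fQbar_mod pr_i); rewrite natr_Zp.
apply: cut_ae (cut_add CN CN).
apply: filterS2 (prime_ae p_prime) xN => i /= pr_i xN.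
by apply: (fQbar_mod_has_complexity pr_i); rewrite natr_Zp.
Qed.

Lemma RC_exp e (x : K) (N : I -> nat) : C (cls N) ->
  F [set i | has_complexity ((N i).+2 ^ e) (residue x i)] -> R x.
Proof.
by move=> CN xN; apply/RCP; exists (fun i => (N i).+2 ^ e)%N; [apply: cut_exp|].
Qed.

Lemma RC_int (z : int) : R z%:~R.
Proof.
apply/RCP; exists (fun=> (absz z).+1); first exact: cut_star.
apply: filterS (lifts_int p_prime z) => i /= ->; apply: has_complexity_int => //.
rewrite -natrX natz -abszE lez_nat ltnW //.
by rewrite (leq_trans (ltn_expl _ (ltnSn 1))) // leq_exp2l.
Qed.

Lemma RC_common_bound d (a : 'I_d -> K) : (forall j, R (a j)) ->
  exists2 N : I -> nat, C (cls N) &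
    F [set i | forall j, has_complexity (N i) (residue (a j) i)].
Proof.
move=> Ra; have /choice[N aN] : forall j, exists N : I -> nat,
    C (cls N) /\ F [set i | has_complexity (N i) (residue (a j) i)].
  by move=> j; have /RCP[N] := Ra j; exists N.
exists (fun i => \sum_j N j i)%N; first by apply: cut_sum => j; have [] := aN j.
apply: filter_forall => j; have [_] := aN j; apply: filterS => i /=.
by apply: has_complexityW; rewrite (bigD1 j) //= leq_addr.
Qed.

Lemma RC_common_bound2 (x y : K) : R x -> R y ->
  exists2 N : I -> nat, C (cls N) &
    F [set i | has_complexity (N i) (residue x i) /\
               has_complexity (N i) (residue y i)].
Proof.
move=> Rx Ry; have [N CN xyN] := RC_common_bound (pair_funP Rx Ry).
exists N => //; apply: filterS xyN => i xyN.
by split; [apply: (xyN 0)|apply: (xyN 1)].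
Qed.

Lemma RC_add (x y : K) : R x -> R y -> R (x + y).
Proof.
move=> Rx Ry; have [N CN xyN] := RC_common_bound2 Rx Ry; apply: (@RC_exp 2 _ _ CN).
apply: filterS2 (liftsD (lifts_residue x) (lifts_residue y)) xyN => i /= -> [].
exact: has_complexityD.
Qed.

Lemma RC_mul (x y : K) : R x -> R y -> R (x * y).
Proof.
move=> Rx Ry; have [N CN xyN] := RC_common_bound2 Rx Ry; apply: (@RC_exp 2 _ _ CN).
apply: filterS2 (liftsM (lifts_residue x) (lifts_residue y)) xyN => i /= -> [].
exact: has_complexityM.
Qed.

Lemma RC_sub (x y : K) : R x -> R y -> R (x - y).
Proof.
move=> Rx Ry; apply: RC_add => //; rewrite -mulN1r.
by apply: RC_mul (RC_int (-1)) _.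
Qed.

Lemma RC_inv (x : K) : R x -> R x^-1.
Proof.
have [-> _|x0 /RCP[N CN xN]] := eqVneq x 0.
  by rewrite invr0; apply: (RC_int 0).
apply: (@RC_exp 3 _ _ CN); have res_x := lifts_residue x.
apply: filterS3 (liftsV res_x) (lifts_neq0 res_x x0) xN => i /= -> x0i xNi.
exact: has_complexityV.
Qed.

Lemma RC_monic_root d (a : 'I_d -> K) (x : K) : (0 < d)%N ->
  (forall j, R (a j)) -> x ^+ d + \sum_(j < d) a j * x ^+ j = 0 -> R x.
Proof.
move=> d0 Ra /monic_root_residue x0; have [N CN aN] := RC_common_bound Ra.
apply: (@RC_exp (d + d) _ _ CN).
by apply: filterS2 x0 aN => i /= x0 aN; apply: has_complexity_root x0.
Qed.

Hypothesis no_sqrtN1 : ~ exists x : K, x ^+ 2 = -1.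
Hypothesis C_sub : C `<=` Cp p_prime.

Lemma RC_solvable d (a : 'I_d -> K) :
  phi_index d -> (forall j, R (a j)) -> exists z, solves a z.
Proof.
move=> dP Ra; have [phi_nhat _] := nhatP no_sqrtN1 dP.
by move/phiP: phi_nhat; apply=> j; apply: Cp_lt_nhat => //; apply: C_sub (Ra j).
Qed.

Theorem RC_real_closed : is_real_closed_field R (@Fle I F FU p p_prime).
Proof.
apply: relatively_closed_subfield_real_closed.
- exact: (RC_int 1).
- exact: RC_sub.
- by move=> x y Rx Ry; apply: RC_mul => //; apply: RC_inv.
- exact: RC_monic_root.
- by move=> x; apply/eqP => x2; apply: no_sqrtN1; exists x.
- exact: Fp_sqr_or_opp.
- move=> x y Rx Ry; have phi2_index : phi_index 2 by [].
  by have [z /solves_pair] := RC_solvable phi2_index (pair_funP Rx Ry); exists z.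
move=> d a odd_d d_gt1 Ra; have [|z] := @RC_solvable d a _ Ra.
  by rewrite /phi_index odd_d d_gt1 orbT.
by rewrite /solves ifN => [z0|]; [exists z|apply: contraTneq odd_d => ->].
Qed.

End CutField.

(** * Elements of standard complexity *)

Lemma bounded_int_poly_enum (n m : nat) :
  exists (T : finType) (Q : T -> {poly int}), forall P : {poly int},
    (size P <= n)%N -> (forall i, `|P`_i| <= m%:Z) -> exists t, P = Q t.
Proof.
pose T := {ffun 'I_n -> 'I_(m + m).+1}.
exists T, (fun t : T => rVpoly (\row_j ((t j)%:Z - m%:Z))) => P szP Pm.
have lt_shift (j : 'I_n) : (absz (P`_j + m%:Z)%R < (m + m).+1)%N.
  by have := Pm j; lia.
exists [ffun j => Ordinal (lt_shift j)].
rewrite -[LHS](poly_rV_K szP); congr rVpoly; apply/rowP => j; rewrite !mxE ffunE /=.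
have := Pm j; rewrite ler_norml => /andP[Pj _].
by rewrite gez0_abs ?addrK // -lerBlDr sub0r.
Qed.

Section StandardComplexity.
Variables (I : Type) (F : set_system I) (FU : UltraFilter F).
Variables (p : hnat FU) (p_prime : hprime p).
Local Notation K := (Fp p_prime).
Local Notation P i := (urep p i).
Local Notation cls u := (ucls FU u).

(* An element of standard complexity is almost everywhere a root of one of
   finitely many integer polynomials, hence a root of a single one of them. *)
Lemma standard_algebraic (x : K) (N : nat) : hlt (fQbar x) (star FU N) ->
  exists2 Q : {poly int}, Q != 0 & root (map_poly intr Q) x.
Proof.
rewrite fQbar_residue => /hlt_ucls xN.
have [T [Q QP]] := bounded_int_poly_enum N.+1 (2 ^ (3 * N ^ 2 + N)).
have : F [set i | exists t, map_poly intr (Q t) != 0 :> {poly 'F_(P i)} /\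
                            root (map_poly intr (Q t)) (residue x i)].
  apply: filterS2 (prime_ae p_prime) xN => i /= pr_i xN.
  have /has_complexity_int_poly[Q' [szQ' Q'N Q'0 Q'x]] :=
    has_complexity_fQbar_mod pr_i (ltnW xN).
  have [|t Q't] := QP Q' szQ'; first by move=> j; rewrite -natz natrX.
  by rewrite natr_Zp in Q'x; exists t; rewrite -Q't.
move=> /(ae_exists_fin FU)[t tP]; exists (Q t).
  by have [i [+ _]] := filter_ex tP; apply: contraNneq => ->; rewrite rmorph0.
apply/rootP/(lifts_eq (lifts_horner_int _ (lifts_residue x)) (lifts_nat _ 0)).
by apply: filterS tP => i [_ /rootP].
Qed.

Lemma CpP (u : I -> nat) : Cp p_prime (cls u) <->
  forall d i, phi_index d -> (0 < i)%N ->
    F [set j | (u j ^ i < urep (nhat p_prime d) j)%N].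
Proof.
have hltE d i : (0 < i)%N -> hlt (cls u) (hceil_root (nhat p_prime d) i) <->
    F [set j | (u j ^ i < urep (nhat p_prime d) j)%N].
  move=> i0; rewrite hlt_hceil_root // hexp_ucls_star -{1}(urepK (nhat _ d)).
  exact: hlt_ucls.
by split=> Cu d i dP i0; apply/hltE => //; apply: Cu.
Qed.

Lemma Cp_cut : is_cut (Cp p_prime).
Proof.
elim/ucls_ind=> u; elim/ucls_ind=> v /hle_ucls uv /CpP Cv; apply/CpP => d i dP i0.
apply: filterS2 uv (Cv d i dP i0) => j /= uv; apply: leq_ltn_trans.
by rewrite leq_exp2r.
Qed.

Hypothesis no_sqrtN1 : ~ exists x : K, x ^+ 2 = -1.
Variable h : {rmorphism realalg -> K}.

Lemma standard_realalg (x : K) (N : nat) : hlt (fQbar x) (star FU N) ->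
  exists b, x = h b.
Proof.
move=> /standard_algebraic[Q Q0 Qx].
apply: (@sqr_neqN1_algebraic_image realalg _ _ K h (map_poly intr Q)).
- by move=> y y0; exists (Num.sqrt y); rewrite sqr_sqrtr.
- by move=> P _ /odd_poly_root[z Pz]; exists z.
- by move=> z; apply/eqP => z2; apply: no_sqrtN1; exists z.
- by rewrite map_poly_eq0_id0 // intr_eq0 lead_coef_eq0.
by rewrite -map_poly_comp (eq_map_poly (g := intr)) // => z; apply: rmorph_int.
Qed.

Lemma phi_standard d (N : nat) : phi_index d -> phi p_prime d (star FU N).
Proof.
move=> dP; apply/phiP => a aN.
have /choice[b ab] := fun j => standard_realalg (aN j).
rewrite /solves; have [d2|d2] := eqVneq d 2%N.
  exists (h (Num.sqrt (\sum_j b j ^+ 2))).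
  rewrite -rmorphXn sqr_sqrtr ?sumr_ge0 // => [|j _]; last exact: sqr_ge0.
  by rewrite rmorph_sum; apply: eq_bigr => j _; rewrite ab rmorphXn.
have odd_d : odd d by move: dP; rewrite /phi_index (negPf d2) => /andP[].
pose Q : {poly realalg} := 'X^d + rVpoly (\row_j b j).
have [|z /rootP Qz] := @odd_poly_root _ Q.
  by rewrite size_polyDl ?size_polyXn /= ?odd_d // ltnS size_poly.
exists (h z); transitivity (h Q.[z]); last by rewrite Qz rmorph0.
rewrite hornerD hornerXn rmorphD rmorphXn.
congr (_ + _); rewrite horner_poly rmorph_sum; apply: eq_bigr => j _.
by rewrite valK mxE rmorphM rmorphXn ab.
Qed.

Lemma Cp_star (n : nat) : Cp p_prime (star FU n).
Proof.
apply/CpP => d i dP i0; have [_ maxn] := nhatP no_sqrtN1 dP.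
have := maxn _ (phi_standard (n ^ i).+1 dP).
by rewrite -{1}(urepK (nhat p_prime d)) => /hle_ucls.
Qed.

Lemma Cp_mul (x y : hnat FU) :
  Cp p_prime x -> Cp p_prime y -> Cp p_prime (hmul x y).
Proof.
elim/ucls_ind: x => u; elim/ucls_ind: y => v /CpP Cu /CpP Cv; rewrite hmul_ucls.
apply/CpP => d i dP i0; have i2 : (0 < i * 2)%N by rewrite muln_gt0 i0.
apply: filterS2 (Cu d _ dP i2) (Cv d _ dP i2) => j /=.
rewrite !expnM => uN vN; rewrite -(ltn_exp2r _ _ (ltn0Sn 1)) expnMn expnMn.
by rewrite -[X in (_ < X)%N]mulnn ltn_mul.
Qed.

Lemma Cp_add (x y : hnat FU) :
  Cp p_prime x -> Cp p_prime y -> Cp p_prime (hadd x y).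
Proof.
elim/ucls_ind: x => u; elim/ucls_ind: y => v Cu Cv; rewrite hadd_ucls.
have Cmax : Cp p_prime (cls (fun i => maxn (u i) (v i))).
  move/CpP: Cu => Cu; move/CpP: Cv => Cv; apply/CpP => d i dP i0.
  by apply: filterS2 (Cu d i dP i0) (Cv d i dP i0) => j /=; case: (leqP (u j)).
apply: Cp_cut (Cp_mul (Cp_star 2) Cmax); rewrite hmul_ucls; apply/hle_ucls.
by apply: filterS filterT => i _ /=; lia.
Qed.

Lemma Cp_subsemiring : is_subsemiring (Cp p_prime).
Proof. by split; [exact: Cp_star|exact: Cp_star|exact: Cp_add|exact: Cp_mul]. Qed.

End StandardComplexity.

Theorem theorem4p8 (I : Type) (F : set_system I) (FU : UltraFilter F)
    (F_incomplete : countably_incomplete F)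
    (p : hnat FU) (p_prime : hprime p)
    (p_nonstandard : forall n : nat, p <> star FU n)
    (real_algebraic_subfield : inhabited {rmorphism realalg -> Fp p_prime})
    (no_sqrtN1 : ~ exists x : Fp p_prime, x ^+ 2 = -1) :
  (forall C : set (hnat FU),
     is_cut C -> is_subsemiring C -> C `<=` Cp p_prime ->
     is_real_closed_field (RC p_prime C) (@Fle I F FU p p_prime)) /\
  is_real_closed_field (RC p_prime (Cp p_prime)) (@Fle I F FU p p_prime).
Proof.
have [h] := real_algebraic_subfield.
split=> [C C_cut C_semiring|]; first exact: RC_real_closed.
apply: RC_real_closed => //; first exact: Cp_cut.
exact: Cp_subsemiring no_sqrtN1 h.
Qed.
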